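(* Let $m,a,l$ be integers with $m\ge 1$ and $a\ge 0$. Then for all integers $n\ge 1$, $$\widehat{\mathcal{D}}_{1,l-1,1}^{(m-1,a)}(n) = \widehat{\mathcal{L}}_{1,l-1,1}^{(m-1,a)}(n) = \det_{0\le i,j\le n-1} \left(l^{j+1}\binom{mi+j+a+1}{mi+a+1} + \binom{mi-j+a-1}{mi+a+1}\right).$$
   Context: Conventions: $\mathbb{N}=\{0,1,2,\ldots\}$; $0^0=1$; for an integer $p$, $\binom{\alpha}{p}=\frac{\alpha(\alpha-1)\cdots(\alpha-p+1)}{p!}$ if $p\ge 0$ and $\binom{\alpha}{p}=0$ if $p<0$ (so $\alpha$ may be negative). A partition of length $n$ is a sequence $\lambda=(\lambda_1,\ldots,\lambda_n)$ of integers with $\lambda_1\ge\cdots\ge\lambda_n\ge 0$. For $s,r\in\mathbb{N}$ put $\lambda^{(s,r)}=(s(n-1)+r,\,s(n-2)+r,\ldots,r)$, a partition of length $n$. Lattice paths. A Delannoy path is a lattice path in $\mathbb{Z}^2$ with steps east $(1,0)$, north $(0,1)$, northeast $(1,1)$. An H-Delannoy path is a Delannoy path that does not end with an east step. For a partition $\lambda$ of length $n$, a system of nonintersecting H-Delannoy paths marked by $\lambda$ is an $n$-tuple $p=(p_1,\ldots,p_n)$ where $p_j$ is an H-Delannoy path from $(-j,j)$ to $(\lambda_j-j,n+1)$ and no two different paths share a lattice point. For $w_1,w_2,w_3\in\mathbb{C}$, the weight of $p$ is $w_1^{e}w_2^{f}w_3^{g}$, where $e,f,g$ are the total numbers of east,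 north, northeast steps in all of $p_1,\ldots,p_n$. $\widehat{\mathcal{L}}_{w_1,w_2,w_3}^{(s,r)}(n)$ is the sum of the weights of all systems of nonintersecting H-Delannoy paths marked by $\lambda^{(s,r)}$. Domino tilings. Label each unit square of the Cartesian grid by its left-top point. For $M,N\in\mathbb{N}$, the prototypical domain $A(M;N)$ is the union, over $0\le k\le N$, of the $k$-th diagonals, the $k$-th diagonal consisting of the $M+\lceil k/2\rceil$ unit squares labeled $(i,i-k)$ with $0\le i\le M+\lceil k/2\rceil-1$. Squares in even-indexed diagonals are white; squares in odd-indexed diagonals are gray. The boundary encoding of a partition $\lambda$ of length $n$ is the word of circles and bullets read along the southeast boundary of its Young diagram (with $n$ rows, zero rows allowed) from southwest to northeast, with a circle for each east edge and a bullet for each north edge; i.e. $\circ^{\lambda_n}\bullet\,\circ^{\lambda_{n-1}-\lambda_n}\bullet\cdots\circ^{\lambda_1-\lambda_2}\bullet$, a word of length $\lambda_1+n$. The Aztec-type domain of Type 2 marked by $\lambda$ is obtained from $A(\lambda_1;2n)$ by writing the boundary encoding of $\lambda$ into the $\lambda_1+n$ squares of its last diagonal from left-bottom to right-top (increasing $i$) and removing the squares that receive a circle. A domino covers two edge-adjacent unit squares; there are four types: $\mathfrak{D}_1$ vertical with gray bottom square and white top square; $\mathfrak{D}_2$ vertical with white bottom and gray top; $\mathfrak{D}_3$ horizontal with gray left and white right; $\mathfrak{D}_4$ horizontal with white left and gray right. The weight of a domino tiling $T$ is $w_1^{\#\mathfrak{D}_1}w_2^{\#\mathfrak{D}_2}w_3^{\#\mathfrak{D}_3}$,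 where $\#\mathfrak{D}_i$ is the number of dominoes of type $\mathfrak{D}_i$ in $T$. $\widehat{\mathcal{D}}_{w_1,w_2,w_3}^{(s,r)}(n)$ is the sum of the weights of all domino tilings of the Type 2 domain marked by $\lambda^{(s,r)}$. *)

(* Defs.v *)
From HB Require Import structures.
From mathcomp Require Import all_boot all_order all_algebra.
From mathcomp Require Import zify.

Set Implicit Arguments.
Unset Strict Implicit.
Unset Printing Implicit Defensive.

Import Order.TTheory GRing.Theory Num.Theory.
Local Open Scope ring_scope.

Definition gbinom (F : fieldType) (alpha : F) (p : int) : F :=
  match p with
  | Posz k => (\prod_(i < k) (alpha - i%:R)) / k`!%:R
  | Negz _ => 0
  end.

(** A partition of length n is a nonincreasing n-tuple of naturals; the part
    written lambda_j (1 <= j <= n) in print is [tnth lam j'] with j = j'.+1. *)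

Definition is_partition (n : nat) (lam : n.-tuple nat) : bool :=
  sorted geq lam.

Definition first_part (n : nat) (lam : n.-tuple nat) : nat := head 0%N lam.

Definition staircase (s r n : nat) : n.-tuple nat :=
  [tuple (s * (n - j.+1) + r)%N | j < n].

Lemma staircase_is_partition (s r n : nat) : is_partition (staircase s r n).
Proof.
apply/(sortedP 0%N) => i; rewrite size_tuple => lt_i.
have lt_i' := ltnW lt_i.
rewrite -!(tnth_nth _ _ (Ordinal lt_i)) -!(tnth_nth _ _ (Ordinal lt_i')) !tnth_mktuple.
by rewrite /geq /= leq_add2r leq_mul2l leq_sub2l ?orbT.
Qed.

Inductive step := East | North | NorthEast.

Definition ord_of_step (t : step) : 'I_3 :=
  match t with East => inord 0 | North => inord 1 | NorthEast => inord 2 end.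

Definition step_of_ord (i : 'I_3) : step :=
  match val i with 0 => East | 1 => North | _ => NorthEast end.

Lemma ord_of_stepK : cancel ord_of_step step_of_ord.
Proof. by case; rewrite /step_of_ord /= inordK. Qed.

HB.instance Definition _ := Equality.copy step (can_type ord_of_stepK).
HB.instance Definition _ := Choice.copy step (can_type ord_of_stepK).
HB.instance Definition _ := Countable.copy step (can_type ord_of_stepK).
HB.instance Definition _ := Finite.copy step (can_type ord_of_stepK).

Definition point : Type := (int * int)%type.

Definition move (u : point) (t : step) : point :=
  match t with
  | East => (u.1 + 1, u.2)
  | North => (u.1, u.2 + 1)
  | NorthEast => (u.1 + 1, u.2 + 1)
  end.

(** A Delannoy path is given by its starting point and its list of steps. *)

Definition path_points (u : point) (p : seq step) : seq point :=
  u :: scanl move u p.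

Definition delannoy_path (u v : point) (p : seq step) : bool :=
  foldl move u p == v.

(** The default [North] makes the second condition hold for the empty path. *)

Definition H_delannoy_path (u v : point) (p : seq step) : bool :=
  delannoy_path u v p && (last North p != East).

Definition path_start (n : nat) (j : 'I_n) : point := (- j.+1%:Z, j.+1%:Z).

Definition path_end (n : nat) (lam : n.-tuple nat) (j : 'I_n) : point :=
  ((tnth lam j)%:Z - j.+1%:Z, n.+1%:Z).

(** Bounding the number of steps only serves to make the systems of paths
    range over a finite type: by [size_marked_path] the bound always holds. *)

Definition path_system (n : nat) (lam : n.-tuple nat) : finType :=
  {ffun 'I_n -> {bseq (first_part lam + n) of step}}.

Definition nonintersecting_H_system (n : nat) (lam : n.-tuple nat)
    (p : path_system lam) : bool :=
  [forall j : 'I_n, H_delannoy_path (path_start j) (path_end lam j) (p j)] &&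
  [forall j : 'I_n, forall k : 'I_n, (j != k) ==>
    ~~ has (mem (path_points (path_start j) (p j)))
           (path_points (path_start k) (p k))].

Definition nb_steps (t : step) (n : nat) (lam : n.-tuple nat)
    (p : path_system lam) : nat :=
  (\sum_(j < n) count_mem t (p j))%N.

Definition system_weight (R : comNzRingType) (w1 w2 w3 : R)
    (n : nat) (lam : n.-tuple nat) (p : path_system lam) : R :=
  w1 ^+ nb_steps East p * w2 ^+ nb_steps North p * w3 ^+ nb_steps NorthEast p.

Definition path_sum (R : comNzRingType) (w1 w2 w3 : R) (s r n : nat) : R :=
  \sum_(p : path_system (staircase s r n) | nonintersecting_H_system p)
     system_weight w1 w2 w3 p.

Lemma delannoy_path_size (u v : point) (p : seq step) :
  delannoy_path u v p -> (size p)%:Z <= (v.1 - u.1) + (v.2 - u.2).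
Proof.
rewrite /delannoy_path => /eqP <- {v}; elim: p u => [|t p IH] u /=.
  by rewrite !subrr.
apply: le_trans (_ : 1 + (((foldl move (move u t) p).1 - (move u t).1) +
  ((foldl move (move u t) p).2 - (move u t).2)) <= _).
  by rewrite -add1n PoszD lerD2l.
set q := foldl _ _ _; case: t @q => q /=; lia.
Qed.

Lemma size_marked_path (n : nat) (lam : n.-tuple nat) (j : 'I_n)
    (p : seq step) :
  is_partition lam -> H_delannoy_path (path_start j) (path_end lam j) p ->
  (size p <= first_part lam + n)%N.
Proof.
move=> lam_part /andP[/delannoy_path_size le_p _].
have le_j : (tnth lam j <= first_part lam)%N.
  rewrite (tnth_nth 0%N) /first_part -nth0.
  have tr : transitive geq by move=> y x z; rewrite /geq /= => /[swap]; apply: leq_trans.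
  have rf : reflexive geq by move=> x; apply: leqnn.
  apply: (sorted_leq_nth tr rf 0%N lam_part) => //; rewrite unfold_in /= size_tuple //.
  exact: leq_ltn_trans (ltn_ord j).
move: le_p; rewrite /path_start /path_end /=; move: (ltn_ord j); lia.
Qed.

(** The cell (i, k) stands for the unit square labeled (i, i - k), the i-th
    square of the k-th diagonal; [label] returns the left-top point.  The cells
    of A(M; N) all lie in the box i < M + ceil (N / 2), k <= N. *)

Definition cell (M N : nat) : finType := ('I_(M + uphalf N) * 'I_N.+1)%type.

Definition label (M N : nat) (c : cell M N) : point :=
  (c.1%:Z, c.1%:Z - c.2%:Z).

Definition prototypical_domain (M N : nat) : {set cell M N} :=
  [set c : cell M N | (c.1 < M + uphalf c.2)%N].

Definition white (M N : nat) (c : cell M N) : bool := ~~ odd c.2.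
Definition gray (M N : nat) (c : cell M N) : bool := odd c.2.

Definition circle : bool := false.
Definition bullet : bool := true.

(** [boundary_word x mu] reads the boundary of the rows mu, listed from the
    bottom one upwards, starting from the abscissa x. *)

Fixpoint boundary_word (x : nat) (mu : seq nat) : seq bool :=
  if mu is y :: mu' then
    nseq (y - x) circle ++ bullet :: boundary_word y mu'
  else [::].

Definition boundary_encoding (n : nat) (lam : n.-tuple nat) : seq bool :=
  boundary_word 0 (rev lam).

Definition type2_domain (n : nat) (lam : n.-tuple nat) :
    {set cell (first_part lam) (2 * n)} :=
  [set c in prototypical_domain (first_part lam) (2 * n) |
    (val c.2 == 2 * n)%N ==>
      (nth circle (boundary_encoding lam) c.1 == bullet)].

Definition below (M N : nat) (b t : cell M N) : bool :=
  label t == ((label b).1, (label b).2 + 1).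

Definition left_of (M N : nat) (u v : cell M N) : bool :=
  label v == ((label u).1 + 1, (label u).2).

Definition domino (M N : nat) (d : {set cell M N}) : bool :=
  [exists u, exists v, (d == [set u; v]) && (below u v || left_of u v)].

Definition domino_D1 (M N : nat) (d : {set cell M N}) : bool :=
  [exists b, exists t, [&& d == [set b; t], below b t, gray b & white t]].

Definition domino_D2 (M N : nat) (d : {set cell M N}) : bool :=
  [exists b, exists t, [&& d == [set b; t], below b t, white b & gray t]].

Definition domino_D3 (M N : nat) (d : {set cell M N}) : bool :=
  [exists u, exists v, [&& d == [set u; v], left_of u v, gray u & white v]].

Definition tiling (M N : nat) (D : {set cell M N})
    (T : {set {set cell M N}}) : bool :=
  partition T D && [forall d in T, domino d].

Definition tiling_weight (R : comNzRingType) (w1 w2 w3 : R) (M N : nat)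
    (T : {set {set cell M N}}) : R :=
  w1 ^+ #|[set d in T | domino_D1 d]| * w2 ^+ #|[set d in T | domino_D2 d]| *
  w3 ^+ #|[set d in T | domino_D3 d]|.

Definition tiling_sum (R : comNzRingType) (w1 w2 w3 : R) (s r n : nat) : R :=
  \sum_(T | tiling (type2_domain (staircase s r n)) T)
     tiling_weight w1 w2 w3 T.

(* Main.v *)
Require Import Defs.
From mathcomp Require Import all_boot all_order all_algebra.
From mathcomp Require Import perm zify ring.

Set Implicit Arguments.
Unset Strict Implicit.
Unset Printing Implicit Defensive.

Import Order.TTheory GRing.Theory Num.Theory.
Local Open Scope ring_scope.

(** Tilings, systems of paths and the determinant are compared through one
    recursion.  Let the heads of the paths start at the prescribed points, all
    on the antidiagonal x + y = 0, and always advance a head on the lowest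
    antidiagonal among those that have not reached their final height.  No other
    path can come through that head any more, so the weighted number of
    nonintersecting systems is the sum over its three steps of the step weight
    times the number from the new heads ([routes_sum_step]).

    The determinant of the matrix of weights of single paths from head i to goal
    k satisfies the same recursion by linearity in a row, and vanishes when two
    heads collide because two rows agree.  The heads stay in northwest order
    ([staggered_move]), which decides the case where all of them have stopped;
    this proves the Lindström-Gessel-Viennot formula without a sign-reversing
    involution ([routes_sum_det]).

    For the tilings, put the cells on lattice points ([cell_point]) so that a
    gray cell matched by a domino D1, D2 or D3 is a point left by an east, north
    or northeast step towards the point of its white partner, while D4 matches
    the gray and the white cell of one point.  Removing the dominoes along
    increasing antidiagonals, a point that is not a head forces a D4, and a head
    leaves the choice among three dominoes, so the weighted number of tilings
    obeys the same recursion again ([sweep_unvisited], [sweep_visited]).  The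
    number of paths equals the number of tilings for every partition and all
    weights ([type2_tilings_eq_paths]).

    It remains to evaluate the determinant.  At each height a path makes east
    steps and then one step up, so for weights 1, l - 1, 1 the matrix entry is
    the coefficient of z^N in Y^(j+1), where Y = z (l - 1 + z) / (1 - z) and
    N = m i + a + 1.  Put u = l / (1 - z) and v = 1 - z.  Then u v = l and
    u + v = Y + l + 1, so u^(j+1) + v^(j+1) is a monic polynomial of degree
    j + 1 in Y.  Its coefficient of z^N is the entry of the asserted matrix, which
    therefore arises from the matrix of path weights by unitriangular column
    operations ([entry_expansion], [det_binomials]). *)

(** * Steps, moves and ranks *)

Definition step_weight (R : comNzRingType) (w1 w2 w3 : R) (t : step) : R :=
  match t with East => w1 | North => w2 | NorthEast => w3 end.

Lemma North_neq_East : North != East.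
Proof. by apply/eqP. Qed.

Lemma big_step (V : nmodType) (f : step -> V) :
  \sum_t f t = f East + f North + f NorthEast.
Proof.
have eq_steps : perm_eq (index_enum step) [:: East; North; NorthEast].
  apply: uniq_perm => [||t]; first exact: index_enum_uniq.
    by rewrite /= !inE; do ?case: eqP.
  by rewrite mem_index_enum !inE; case: t; rewrite eqxx ?orbT.
by rewrite (perm_big _ eq_steps) !big_cons big_nil /= addr0 addrA.
Qed.

Definition replace_at (n : nat) (T : Type) (u : 'I_n -> T) (i : 'I_n) (x : T)
    (j : 'I_n) : T :=
  if j == i then x else u j.

Lemma replace_at_inj (n : nat) (T : eqType) (u : 'I_n -> T) i x :
  injective u -> (forall j, j != i -> u j != x) -> injective (replace_at u i x).
Proof.
move=> u_inj miss j k; rewrite /replace_at.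
case: (eqVneq j i) => [->|neq_j]; case: (eqVneq k i) => [->|neq_k] // eq_u.
- by have := miss k neq_k; rewrite eq_u eqxx.
- by have := miss j neq_j; rewrite eq_u eqxx.
- exact: u_inj.
Qed.

Lemma move_inj (q : point) : injective (move q).
Proof. by case: q => x y; do 2!case=> //=; case; lia. Qed.

Lemma move_le (q : point) (t : step) : q.1 <= (move q t).1 /\ q.2 <= (move q t).2.
Proof. by case: t => /=; lia. Qed.

(** The index of an antidiagonal.  Every step raises it, so a path through [q]
    started at a point of rank at least [rank q] can only have started at [q]. *)
Definition rank (q : point) : int := q.1 + q.2.

Lemma rank_move (q : point) (t : step) : rank q + 1 <= rank (move q t).
Proof. by case: t; rewrite /rank /=; lia. Qed.

Lemma path_points_le (u q : point) (s : seq step) :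
  q \in path_points u s -> (u.1 <= q.1) && (u.2 <= q.2).
Proof.
rewrite /path_points; elim: s u => [|t s IH] u /=.
  by rewrite inE => /eqP ->; rewrite !lexx.
rewrite inE => /orP[/eqP -> | /IH]; first by rewrite !lexx.
by case: t => /=; lia.
Qed.

Lemma end_in_path_points (u v : point) (s : seq step) :
  delannoy_path u v s -> v \in path_points u s.
Proof.
rewrite /delannoy_path /path_points => /eqP <-.
elim: s u => [|t s IH] u /=; first by rewrite mem_head.
by rewrite inE IH orbT.
Qed.

(** * Advancing one path of a nonintersecting system *)

Section Routes.

Variables (R : comNzRingType) (w : step -> R) (n : nat) (B : nat).
Variable v : 'I_n -> point.
Implicit Types (u : 'I_n -> point).

(** Route j leads from the head [u j] to the goal [v j]; in the course of the
    argument the heads move up from the starting points to the goals.  The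
    bound [B] on the lengths only provides a finite type to sum over. *)
Definition routes u (p : {ffun 'I_n -> {bseq B of step}}) : bool :=
  [forall j, H_delannoy_path (u j) (v j) (p j)] &&
  [forall j, forall k, (j != k) ==>
    ~~ has (mem (path_points (u j) (p j))) (path_points (u k) (p k))].

Definition routes_sum u : R :=
  \sum_(p | routes u p) \prod_j \prod_(t <- p j) w t.

Lemma routes_sum_collision u j k : j != k -> u j = u k -> routes_sum u = 0.
Proof.
move=> neq_jk eq_u; apply: big1 => p /andP[_ /forallP/(_ j)/forallP/(_ k)].
rewrite neq_jk implyTb => /hasPn disj; have := disj (u k) (mem_head _ _).
by rewrite /= -eq_u mem_head.
Qed.

Lemma routes_sum_overshoot u i : (v i).1 < (u i).1 -> routes_sum u = 0.
Proof.
move=> lt_vu; apply: big1 => p /andP[/forallP/(_ i)/andP[path_i _] _].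
by have /path_points_le := end_in_path_points path_i; move: lt_vu; lia.
Qed.

(** At the height of its goal a path has only east steps left, and it may not
    end with one. *)
Lemma H_path_at_top (a b : point) (s : seq step) :
  a.2 = b.2 -> H_delannoy_path a b s = (a == b) && nilp s.
Proof.
move=> eq_ab; rewrite /H_delannoy_path /delannoy_path.
case/lastP: s => [|s t].
  by rewrite /= North_neq_East !andbT.
rewrite /nilp size_rcons andbF last_rcons; apply/negP=> /andP[/eqP eq_b not_east].
have := path_points_le (@end_in_path_points a _ s (eqxx _)).
rewrite foldl_rcons in eq_b; move: eq_ab; rewrite -eq_b.
by case: t not_east {eq_b} => //=; rewrite ?eqxx //; lia.
Qed.

Lemma routes_sum_dead_end u i :
  (u i).2 = (v i).2 -> u i != v i -> routes_sum u = 0.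
Proof.
move=> eq2 neq; apply: big1 => p /andP[/forallP/(_ i)].
by rewrite H_path_at_top // (negPf neq).
Qed.

Lemma routes_sum_arrived u :
  injective v -> u =1 v -> routes_sum u = 1.
Proof.
move=> v_inj eq_uv; pose p0 : {ffun 'I_n -> {bseq B of step}} := [ffun=> [bseq]].
rewrite /routes_sum (big_pred1 p0); last first.
  move=> p; apply/andP/eqP => [[/forallP H _] | ->].
    apply/ffunP=> i; apply/val_inj; rewrite ffunE /=.
    by have := H i; rewrite H_path_at_top ?eq_uv // => /andP[_ /nilP].
  split; first by apply/forallP=> i; rewrite ffunE H_path_at_top eq_uv ?eqxx.
  apply/forallP=> j; apply/forallP=> k; apply/implyP=> neq_jk; rewrite !ffunE /=.
  by rewrite orbF inE !eq_uv; apply: contraNN neq_jk => /eqP/v_inj ->.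
by apply: big1 => j _; rewrite ffunE /= big_nil.
Qed.

Definition set_route (p : {ffun 'I_n -> {bseq B of step}}) i (s : seq step) :
    {ffun 'I_n -> {bseq B of step}} :=
  [ffun j => if j == i then insub_bseq B s else p j].

Lemma set_routeE p i s j : (size s <= B)%N ->
  set_route p i s j = (if j == i then s else p j) :> seq step.
Proof.
by move=> le_s; rewrite ffunE; case: eqP => // _; rewrite /insub_bseq insubdK.
Qed.

(** The first step of route i is free as soon as no other route can come through
    [u i]: what remains is a system of routes from the advanced heads, and if
    two heads collide the sum on the right vanishes by itself.  The determinant
    below obeys the same recursion. *)
Lemma routes_sum_step u i :
    (u i).2 < (v i).2 ->
    (forall k, k != i -> ~~ ((u k).1 <= (u i).1) || ~~ ((u k).2 <= (u i).2)) ->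
    (v i).1 - (u i).1 + ((v i).2 - (u i).2) <= B%:Z ->
  routes_sum u = \sum_t w t * routes_sum (replace_at u i (move (u i) t)).
Proof.
move=> lt_top unreach le_B.
have routes_cons (p : {ffun 'I_n -> {bseq B of step}}) s t : (size s < B)%N ->
    routes u (set_route p i (t :: s)) =
    routes (replace_at u i (move (u i) t)) (set_route p i s).
  move=> lt_s; rewrite /routes; congr andb.
    apply: eq_forallb => j; rewrite !set_routeE ?(ltnW lt_s) // /replace_at.
    case: eqP => // ->; rewrite /H_delannoy_path /delannoy_path /=.
    case: eqP => //= eq_v; case: s lt_s eq_v => //= _ eq_v.
    rewrite North_neq_East; move: eq_v lt_top.
    by case: t => // <-; rewrite ?ltxx // => _; apply/eqP.
  apply: eq_forallb => j; apply: eq_forallb => k; rewrite !set_routeE ?(ltnW lt_s) //.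
  case: (eqVneq j k) => // neq_jk; rewrite !implyTb /replace_at.
  have notin q s' : q != i -> u i \notin path_points (u q) s'.
    by move=> /unreach H; apply/negP => /path_points_le; lia.
  have points_cons q : path_points q (t :: s) = q :: path_points (move q t) s by [].
  have has_mem_cons (q : point) (r : seq point) s' :
    has (mem r) (q :: s') = (q \in r) || has (mem r) s' by [].
  case: (eqVneq j i) => [eq_ji|neq_ji]; case: (eqVneq k i) => [eq_ki|neq_ki] //.
  - by rewrite eq_ji eq_ki eqxx in neq_jk.
  - rewrite eq_ji has_sym [in RHS]has_sym points_cons.
    by rewrite (has_mem_cons (u i)) (negPf (notin _ _ neq_ki)).
  - by rewrite eq_ki points_cons (has_mem_cons (u i)) (negPf (notin _ _ neq_ji)).
(* The map that adds the step t to route i is inverted by [behead].  It is defined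
   only on routes shorter than [B], which all routes from the new head are. *)
have nonempty (p : {ffun 'I_n -> {bseq B of step}}) : routes u p -> ~~ nilp (p i).
  move=> /andP[/forallP/(_ i)/andP[path_i _] _]; apply: contraTN path_i.
  rewrite /delannoy_path => /nilP -> /=; apply: contraTN lt_top => /eqP ->.
  by rewrite ltxx.
(* The default value of [head] is never used. *)
rewrite /routes_sum (partition_big (fun p : {ffun 'I_n -> {bseq B of step}} =>
  head North (p i)) xpredT) //=.
apply: eq_bigr => t _; rewrite big_distrr /=.
rewrite (reindex_onto (fun p : {ffun 'I_n -> {bseq B of step}} =>
  set_route p i (t :: p i)) (fun p => set_route p i (behead (p i)))) /=; last first.
  move=> p /andP[/nonempty p_i /eqP head_p]; apply/ffunP=> j; apply/val_inj => /=.
  have size_behead_p : (size (behead (p i)) <= B)%N.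
    by rewrite size_behead; apply: leq_trans (leq_pred _) (size_bseq _).
  have cons_p : t :: behead (p i) = p i.
    by move: p_i head_p; case: (p i : seq _) => //= ? ? _ ->.
  rewrite !set_routeE ?eqxx // ?cons_p ?size_bseq //.
  by case: eqP => // ->.
have set_id p s s' : set_route (set_route p i s) i s' = set_route p i s'.
  by apply/ffunP=> j; rewrite !ffunE; case: eqP.
have set_self p : set_route p i (p i) = p.
  apply/ffunP=> j; apply/val_inj; rewrite /= set_routeE ?size_bseq //.
  by case: eqP => // ->.
have lt_size p : routes (replace_at u i (move (u i) t)) p -> (size (p i) < B)%N.
  move=> /andP[/forallP/(_ i)/andP[/delannoy_path_size le_p _] _].
  move: le_p; rewrite /replace_at eqxx; have := rank_move (u i) t.
  by move: le_B; rewrite /rank; lia.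
apply: eq_big => [p | p].
  case: (ltnP (size (p i)) B) => [lt_p | le_p].
    rewrite routes_cons // set_self set_routeE // eqxx /= eqxx andbT set_id set_self.
    by rewrite eqxx andbT.
  apply/idP/idP => [/andP[/andP[/nonempty + _] _] | /lt_size]; last by rewrite ltnNge le_p.
  by rewrite ffunE eqxx /insub_bseq /insubd insubF //= ltnNge le_p.
move=> /andP[/andP[+ _] _].
case: (ltnP (size (p i)) B) => [lt_p _ | le_p /nonempty]; last first.
  by rewrite ffunE eqxx /insub_bseq /insubd insubF //= ltnNge le_p.
rewrite (bigD1 i) //= [in RHS](bigD1 i) //= set_routeE // eqxx big_cons -mulrA.
congr (_ * (_ * _)); apply: eq_bigr => j neq_ji.
by rewrite set_routeE // (negPf neq_ji).
Qed.
End Routes.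

(** * The order of the heads *)

Section Staggered.
Variables (n : nat) (top : int).
Implicit Types (u v : 'I_n -> point).

(** The order in which the starting points lie, from southeast to northwest.
    Heads that keep it can only be linked to the goals in their own order,
    which is why no permutation of the goals enters the determinant. *)
Definition staggered u : Prop :=
  forall i k : 'I_n, (i < k)%N -> (u k).1 <= (u i).1 /\ (u i).2 <= (u k).2.

(** A head that still has to climb and lies on the lowest antidiagonal occupied
    by such heads. *)
Definition front u (i : 'I_n) : Prop :=
  (u i).2 < top /\ forall k, (u k).2 < top -> rank (u i) <= rank (u k).

Lemma exists_front u k : (u k).2 < top -> exists i, front u i.
Proof.
move=> lt_k; case: (@arg_minP _ int 'I_n k (fun j => (u j).2 < top)
  (fun j => rank (u j)) lt_k) => i lt_i min_i.
by exists i; split=> // j; exact: min_i.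
Qed.

Lemma front_unreachable u i k :
  injective u -> front u i -> k != i ->
  ~~ ((u k).1 <= (u i).1) || ~~ ((u k).2 <= (u i).2).
Proof.
move=> u_inj [lt_i min_i] neq_ki; rewrite -negb_and; apply/negP=> /andP[le1 le2].
have := min_i k (le_lt_trans le2 lt_i); rewrite /rank => le_r.
case/eqP: neq_ki; apply: u_inj.
by rewrite [LHS]surjective_pairing [RHS]surjective_pairing; congr pair; lia.
Qed.

Lemma front_ge u i t : front u i -> (forall k, (u k).2 <= top) ->
  forall k, (replace_at u i (move (u i) t) k).2 <= top.
Proof.
move=> [lt_i _] le_top k; rewrite /replace_at; case: eqP => // _.
by move: lt_i; case: t => /=; lia.
Qed.

(** A step could only break the order against a head lying due west or due south
    of the front one; such a head would have smaller rank. *)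
Lemma staggered_move u i t :
  (forall k, (u k).2 <= top) -> injective u -> staggered u -> front u i ->
  staggered (replace_at u i (move (u i) t)).
Proof.
move=> le_top u_inj stag fr_i j k lt_jk.
have neq_jk : j != k by apply: contraTneq lt_jk => ->; rewrite ltnn.
have unreach := front_unreachable u_inj fr_i.
have [le1 le2] := stag _ _ lt_jk; rewrite /replace_at.
case: (eqVneq k i) => [eq_k|_]; case: (eqVneq j i) => [eq_j|_].
- by rewrite eq_j eq_k eqxx in neq_jk.
- have := unreach j; rewrite -eq_k => /(_ neq_jk).
  by have [+ _] := fr_i; have := le_top j; rewrite -eq_k; case: t => /=; lia.
- have neq_kj : k != j by rewrite eq_sym.
  have := unreach k; rewrite -eq_j => /(_ neq_kj).
  by have [+ _] := fr_i; have := le_top k; rewrite -eq_j; case: t => /=; lia.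
- by split.
Qed.

Lemma increasing_ord_id (s : 'I_n -> 'I_n) :
  (forall i j : 'I_n, (i < j)%N -> (s i < s j)%N) -> s =1 id.
Proof.
move=> s_inc.
have ge_s (m : nat) (i : 'I_n) : m = i :> nat -> (i <= s i)%N.
  elim: m i => [|m IH] i eq_i; first by rewrite -eq_i.
  have lt_m : (m < n)%N by rewrite ltnW // eq_i ltn_ord.
  have := s_inc (Ordinal lt_m) i; rewrite /= -eq_i ltnSn => /(_ isT).
  by apply: leq_ltn_trans; exact: (IH (Ordinal lt_m)).
have le_s (m : nat) (i : 'I_n) : (i + m).+1 = n -> (s i <= i)%N.
  elim: m i => [|m IH] i eq_i; first by rewrite -ltnS; move: (ltn_ord (s i)); lia.
  have lt_i : (i.+1 < n)%N by lia.
  have := s_inc i (Ordinal lt_i); rewrite /= ltnSn => /(_ isT) /leq_trans lt_s.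
  by rewrite -ltnS; apply: lt_s; apply: IH => /=; lia.
move=> i; apply/val_inj/eqP; rewrite eqn_leq (ge_s i) // (le_s (n - i.+1)%N) //.
by have := ltn_ord i; lia.
Qed.

(** Two decreasing arrangements of the same points agree place by place. *)
Lemma staggered_eq u v :
  (forall i, (u i).2 = top) -> (forall i, (v i).2 = top) ->
  injective u -> staggered u -> staggered v ->
  (forall i, exists k, u i = v k) -> u =1 v.
Proof.
move=> u_top v_top u_inj u_stag v_stag sub_uv.
have eq_pt (p q : point) : p.2 = top -> q.2 = top -> p.1 = q.1 -> p = q.
  by case: p q => [? ?] [? ?] /= -> -> ->.
have {}sub_uv i : exists k, u i == v k.
  by have [k ->] := sub_uv i; exists k.
pose s i := xchoose (sub_uv i).
have sE i : u i = v (s i) by apply/eqP; exact: (xchooseP (sub_uv i)).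
have s_id : s =1 id.
  apply: increasing_ord_id => i j lt_ij; have [le1 _] := u_stag _ _ lt_ij.
  have neq1 : (u j).1 != (u i).1.
    apply: contraTneq lt_ij => /(eq_pt _ _ (u_top j) (u_top i))/u_inj ->.
    by rewrite ltnn.
  rewrite ltnNge; apply/negP=> le_s; move: neq1 le1; rewrite !sE.
  move: le_s; rewrite leq_eqVlt => /orP[/eqP/val_inj -> | /v_stag[+ _]].
    by rewrite eqxx.
  by lia.
by move=> i; rewrite sE s_id.
Qed.

End Staggered.

(** * The determinant of a nonintersecting system *)

Section Links.
Variables (R : comNzRingType) (w : step -> R).

(** If the sequence [row] has generating function f(z), then [next_row row] has
    generating function f(z) (w2 + w3 z) / (1 - w1 z): at each height a path
    makes some east steps, then one north or northeast step.  Hence [H_weight h]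
    lists the coefficients of ((w2 + w3 z) / (1 - w1 z))^h. *)
Fixpoint next_row (row : nat -> R) (d : nat) : R :=
  if d is d'.+1
  then w East * next_row row d' + w North * row d + w NorthEast * row d'
  else w North * row 0%N.

Fixpoint H_weight (h : nat) : nat -> R :=
  if h is h'.+1 then next_row (H_weight h') else fun d => (d == 0%N)%:R.

Definition link (a b : point) : R :=
  if (a.1 <= b.1) && (a.2 <= b.2) then H_weight (absz (b.2 - a.2)%R) (absz (b.1 - a.1)%R)
  else 0.

Lemma link_step (a b : point) :
  a.2 < b.2 -> link a b = \sum_t w t * link (move a t) b.
Proof.
move=> lt2; rewrite big_step /link /=.
have -> : absz (b.2 - a.2)%R = (absz (b.2 - (a.2 + 1))%R).+1 by lia.
case: (ltrgtP a.1 b.1) => lt1 /=.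
- have -> : (a.1 + 1 <= b.1) by lia.
  have -> : (a.2 <= b.2) by lia.
  have -> : (a.2 + 1 <= b.2) by lia.
  have -> : absz (b.1 - a.1)%R = (absz (b.1 - (a.1 + 1))%R).+1 by lia.
  by [].
- have -> : (a.1 + 1 <= b.1) = false by lia.
  by rewrite !mulr0 !addr0.
have -> : (a.1 + 1 <= b.1) = false by lia.
have -> : (a.2 <= b.2) by lia.
have -> : (a.2 + 1 <= b.2) by lia.
have -> : absz (b.1 - a.1)%R = 0%N by lia.
by rewrite !mulr0 addr0 add0r.
Qed.

Lemma link_top (a b : point) : a.2 = b.2 -> link a b = (a == b)%:R.
Proof.
case: a b => [x h] [y k] /= ->; rewrite /link /= lexx andbT subrr /= xpair_eqE eqxx andbT.
case: leP => [le_xy | lt_yx]; last by rewrite gt_eqF.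
by congr (_ %:R); lia.
Qed.

Lemma link_overshoot (a b : point) : b.1 < a.1 -> link a b = 0.
Proof. by rewrite /link leNgt => ->. Qed.

Variables (n B : nat) (top : int) (v : 'I_n -> point).
Hypotheses (v_top : forall i, (v i).2 = top) (v_inj : injective v)
  (v_stag : staggered v).

Definition link_matrix (u : 'I_n -> point) : 'M[R]_n :=
  \matrix_(i, k) link (u i) (v k).

Implicit Types (u : 'I_n -> point).

(** The recursion of [routes_sum_step], by linearity in row i. *)
Lemma det_link_step u i : (u i).2 < top ->
  \det (link_matrix u) =
  \sum_t w t * \det (link_matrix (replace_at u i (move (u i) t))).
Proof.
move=> lt_i; under [RHS]eq_bigr do rewrite (expand_det_row _ i) big_distrr /=.
rewrite (expand_det_row _ i) exchange_big /=; apply: eq_bigr => k _.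
rewrite mxE link_step ?v_top // big_distrl /=; apply: eq_bigr => t _.
rewrite mxE -mulrA /replace_at eqxx; congr (_ * (_ * _)).
rewrite /cofactor; congr (_ * determinant _); apply/matrixP=> j l.
by rewrite !mxE eq_sym (negPf (neq_lift _ _)).
Qed.

Lemma det_link_collision u j k : j != k -> u j = u k -> \det (link_matrix u) = 0.
Proof.
by move=> neq_jk eq_u; apply: (determinant_alternate neq_jk) => l; rewrite !mxE eq_u.
Qed.

Lemma det_link_row0 u i :
  (forall k, link (u i) (v k) = 0) -> \det (link_matrix u) = 0.
Proof.
by move=> u0; rewrite (expand_det_row _ i) big1 // => k _; rewrite mxE u0 mul0r.
Qed.

(** Both sides obey the same recursion when a front head is advanced, and both
    vanish when two heads collide, when a head has passed all goals, and when a
    head stops beside the goals.  If all heads stop on goals they are staggered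
    like them, so that there is a single system of routes, which is empty, and
    the matrix is the identity. *)
Lemma routes_sum_det u :
    injective u -> staggered u -> (forall i, (u i).2 <= top) ->
    (forall i, (v i).1 - (u i).1 + ((v i).2 - (u i).2) <= B%:Z) ->
  routes_sum w B v u = \det (link_matrix u).
Proof.
(* [X] lies weakly east of all goals and [N] bounds the sum of the distances of
   the heads from the antidiagonal of the point ([X], [top]). *)
have [X le_X] : exists X : int, forall i, (v i).1 <= X.
  exists (\sum_i `|(v i).1|) => i; rewrite (bigD1 i) //=.
  by apply: le_trans (ler_norm _) _; rewrite lerDl sumr_ge0.
have [N] : exists N : nat, \sum_i (X + top - rank (u i)) < N%:Z.
  by move: (\sum_i _) => S; exists (absz S).+1; lia.
elim: N u => [|N IH] u lt_N u_inj u_stag u_top le_B.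
all: have [/existsP[i lt_i] | /existsPn ge_X] := boolP [exists i, X < (u i).1].
1,3: have lt_vu k : (v k).1 < (u i).1 by exact: le_lt_trans (le_X k) lt_i.
1,2: rewrite (routes_sum_overshoot _ _ (lt_vu i)) (det_link_row0 (i := i)) // => k.
1,2: exact: link_overshoot.
all: have {}ge_X i : (u i).1 <= X by rewrite leNgt; exact: ge_X.
  have : 0 <= \sum_i (X + top - rank (u i)).
    by apply: sumr_ge0 => i _; have := ge_X i; have := u_top i; rewrite /rank; lia.
  by rewrite leNgt lt_N.
have [/existsP[k lt_k] | /existsPn at_top] := boolP [exists i, (u i).2 < top].
  have [i fr_i] := exists_front lt_k; have [lt_i _] := fr_i.
  have lt_vi : (u i).2 < (v i).2 by rewrite v_top.
  have unreach j := front_unreachable (k := j) u_inj fr_i.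
  rewrite (det_link_step lt_i) (routes_sum_step _ lt_vi unreach (le_B i)).
  apply: eq_bigr => t _; congr (_ * _).
  pose u' := replace_at u i (move (u i) t).
  have [/existsP[j /andP[neq_ji /eqP eq_j]] | /existsPn miss] :=
      boolP [exists j, (j != i) && (u j == move (u i) t)].
    have eq_u' : u' j = u' i by rewrite /u' /replace_at eqxx (negPf neq_ji).
    by rewrite (routes_sum_collision _ _ _ neq_ji) ?(det_link_collision neq_ji).
  apply: IH => //; rewrite -/u'.
  - rewrite (bigD1 i) //= in lt_N; rewrite (bigD1 i) //= {1}/u' /replace_at eqxx.
    rewrite (eq_bigr (fun j => X + top - rank (u j))) => [|j neq_ji].
      by move: lt_N (rank_move (u i) t); move: (\sum_(_ | _) _) => S; lia.
    by rewrite /u' /replace_at (negPf neq_ji).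
  - apply: replace_at_inj => // j neq_ji; have := miss j.
    by rewrite neq_ji.
  - exact: staggered_move.
  - exact: front_ge.
  move=> j; have := le_B j; rewrite /u' /replace_at; case: eqP => // ->.
  by have := rank_move (u i) t; rewrite /rank; lia.
have {}at_top i : (u i).2 = top.
  by apply/eqP; rewrite eq_le u_top leNgt at_top.
have [/forallP sub | /forallPn[i /existsPn no_end]] :=
    boolP [forall i, [exists k, u i == v k]].
  have eq_uv : u =1 v.
    by apply: (@staggered_eq n top) => // i; have /existsP[k /eqP] := sub i; exists k.
  rewrite routes_sum_arrived //; suff -> : link_matrix u = 1%:M by rewrite det1.
  by apply/matrixP=> i k; rewrite !mxE eq_uv link_top ?v_top // (inj_eq v_inj).
rewrite (@routes_sum_dead_end _ _ _ _ _ _ i) ?v_top //.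
by rewrite (@det_link_row0 _ i) // => k; rewrite link_top ?v_top // (negPf (no_end k)).
Qed.
End Links.

(** * The determinant of binomial coefficients *)

Lemma det_rev (R : comNzRingType) (n : nat) (A : 'M[R]_n) :
  \det (\matrix_(i, j) A (rev_ord i) (rev_ord j)) = \det A.
Proof.
pose s := perm (@rev_ord_inj n).
have -> : \matrix_(i, j) A (rev_ord i) (rev_ord j) = row_perm s (col_perm s A).
  by apply/matrixP=> i j; rewrite !mxE !permE.
rewrite row_permE col_permE !det_mulmx !det_perm odd_permV.
by rewrite mulrCA -expr2 sqrr_sign mulr1.
Qed.

Section GeometricSeries.
Variable (R : comNzRingType) (K : nat).
Implicit Types p q e : {poly R}.

(** The inverse of 1 - X modulo X^K: power series are replaced by polynomials
    whose coefficients are only looked at below degree K. *)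
Definition geom : {poly R} := \poly_(i < K) 1.

Lemma geomE : (1 - 'X) * geom = 1 - 'X^K.
Proof.
rewrite -[1 - 'X^K]opprB subrX1 -mulNr opprB /geom poly_def; congr (_ * _).
by apply: eq_bigr => i _; rewrite scale1r.
Qed.

(** Division of [q] by 1 - X modulo X^K, coefficient by coefficient. *)
Lemma coef_1subX p q e d : (d < K)%N ->
  (1 - 'X) * p = q + 'X^K * e ->
  p`_d = q`_d + (if d is d'.+1 then p`_d' else 0).
Proof.
move=> lt_d /(congr1 (fun r : {poly R} => r`_d)).
rewrite mulrBl mul1r coefB coefD coefXM coefXnM lt_d addr0 => <-.
by case: d {lt_d} => [|d] /=; rewrite ?subr0 ?addr0 ?subrK.
Qed.

Lemma coef_geomX j d : (d < K)%N -> (geom ^+ j.+1)`_d = ('C(d + j, j))%:R.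
Proof.
elim: j d => [|j IHj] d lt_d.
  by rewrite expr1 coef_poly lt_d bin0.
elim: d lt_d => [|d IHd] lt_d.
  rewrite (@coef_1subX _ (geom ^+ j.+1) (- geom ^+ j.+1)) //; last first.
    by rewrite exprS mulrA geomE; ring.
  by rewrite IHj // addr0 !add0n !binn.
rewrite (@coef_1subX _ (geom ^+ j.+1) (- geom ^+ j.+1)) //; last first.
  by rewrite exprS mulrA geomE; ring.
rewrite IHj // IHd ?(ltnW lt_d) // -natrD; congr (_%:R).
by rewrite -addSnnS [(d.+1 + j.+1)%N]addnS binS addnC.
Qed.

End GeometricSeries.

Lemma coef_1subX_exp (R : comNzRingType) (n d : nat) :
  ((1 - 'X : {poly R}) ^+ n)`_d = (-1) ^+ d * ('C(n, d))%:R.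
Proof.
elim: n d => [|n IH] d; first by rewrite expr0 coef1; case: d => [|d]; rewrite ?mulr0 ?mulr1.
rewrite exprS mulrBl mul1r coefB coefXM !IH; case: d => [|d] /=; first by rewrite !bin0 subr0.
rewrite binS natrD exprS; ring.
Qed.

Section Gbinom.
Variable F : numFieldType.

(** The coefficient of z^N in (1 - z)^-(j+1). *)
Lemma gbinom_nat (N j : nat) : gbinom (N%:R + j%:R : F) N%:Z = ('C(N + j, N))%:R.
Proof.
rewrite /gbinom; apply: canLR (mulfK _) _; first by rewrite pnatr_eq0 -lt0n fact_gt0.
rewrite -natrM bin_ffact ffact_prod natr_prod; apply: eq_bigr => i _.
by rewrite natrB ?natrD //; have := ltn_ord i; lia.
Qed.

(** The coefficient of z^N in (1 - z)^(j+1): the numerator of the binomial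
    coefficient read backwards is, up to sign, a falling factorial of j + 1. *)
Lemma gbinom_neg (N j : nat) :
  gbinom (N%:R - 2 - j%:R : F) N%:Z = (-1) ^+ N * ('C(j.+1, N))%:R.
Proof.
rewrite /gbinom; apply: canLR (mulfK _) _; first by rewrite pnatr_eq0 -lt0n fact_gt0.
rewrite -mulrA -natrM bin_ffact (reindex_inj rev_ord_inj) /=.
case: (leqP N j.+1) => [le_N | lt_N].
  have -> : (-1) ^+ N = \prod_(i < N) (-1 : F) by rewrite prodr_const card_ord.
  rewrite ffact_prod natr_prod -big_split /=.
  apply: eq_bigr => i _; have lt_i := ltn_ord i.
  by rewrite !natrB //; [rewrite -!natr1; ring | lia].
rewrite ffact_small // mulr0 (bigD1 (Ordinal lt_N)) //= natrB //.
by rewrite -!natr1; ring.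
Qed.

End Gbinom.

Section Lucas.
Variables (R : comNzRingType) (l : R).

(** Shifted Dickson polynomials: if u v = l then u^n + v^n is the value of
    [lucas n] at u + v - (l + 1).  The shift is chosen so that for
    u = l / (1 - z) and v = 1 - z the argument is z (l - 1 + z) / (1 - z). *)
Fixpoint lucas (n : nat) : {poly R} :=
  match n with
  | 0 => 2%:R%:P
  | n'.+1 => if n' is n''.+1
             then ('X + (l + 1)%:P) * lucas n' - l%:P * lucas n''
             else 'X + (l + 1)%:P
  end.

Arguments lucas : simpl never.

Lemma lucas1 : lucas 1 = 'X + (l + 1)%:P.
Proof. by []. Qed.

Lemma lucasSS n :
  lucas n.+2 = ('X + (l + 1)%:P) * lucas n.+1 - l%:P * lucas n.
Proof. by []. Qed.

Lemma coef_lucas_gt n k : (n < k)%N -> (lucas n)`_k = 0.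
Proof.
elim/ltn_ind: n k => -[|[|n]] IH k lt_k.
- by rewrite coefC; case: k lt_k.
- by rewrite lucas1 coefD coefX coefC; case: k lt_k => [|[|k]] //= _; rewrite addr0.
rewrite lucasSS mulrDl coefB coefD coefXM !coefCM; case: k lt_k => //= k lt_k.
by rewrite !IH ?mulr0 ?addr0 ?subr0 //; lia.
Qed.

Lemma coef_lucas_lead n : (lucas n.+1)`_n.+1 = 1.
Proof.
elim: n => [|n IH]; first by rewrite lucas1 coefD coefX coefC /= addr0.
rewrite lucasSS mulrDl coefB coefD coefXM !coefCM /= IH.
by rewrite !coef_lucas_gt ?mulr0 ?addr0 ?subr0 // ltnW.
Qed.

Lemma size_lucas n : (size (lucas n) <= n.+1)%N.
Proof. by apply/leq_sizeP => k; exact: coef_lucas_gt. Qed.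

(** The power sum identity modulo [P], by the recursion
    u^(n+2) + v^(n+2) = (u + v) (u^(n+1) + v^(n+1)) - u v (u^n + v^n). *)
Lemma lucas_power_sum n (P Y u v e : {poly R}) :
    u + v = Y + (l + 1)%:P + P * e -> u * v = l%:P * (1 - P) ->
  exists e', u ^+ n + v ^+ n = lucas n \Po Y + P * e'.
Proof.
move=> Euv Muv; elim/ltn_ind: n => -[|[|n]] IH.
- by exists 0; rewrite comp_polyC !expr0 mulr0 addr0 mulr2n polyCD.
- by exists e; rewrite lucas1 !expr1 comp_polyD comp_polyX comp_polyC Euv.
have [e1 E1] := IH n.+1 (ltnSn _); have [e0 E0] := IH n (ltnW (ltnSn _)).
exists (e1 * (Y + (l + 1)%:P + P * e) + e * (lucas n.+1 \Po Y)
        - l%:P * (1 - P) * e0 + l%:P * (lucas n \Po Y)).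
have -> : u ^+ n.+2 + v ^+ n.+2 =
    (u + v) * (u ^+ n.+1 + v ^+ n.+1) - (u * v) * (u ^+ n + v ^+ n).
  by rewrite !exprS; ring.
rewrite E1 E0 Euv Muv lucasSS comp_polyB !comp_polyM comp_polyD comp_polyX !comp_polyC.
ring.
Qed.

End Lucas.

Arguments lucas : simpl never.

Section Determinant.
Variables (F : numFieldType) (l : F).

Let w := step_weight 1 (l - 1) (1 : F).

Lemma coef_H_weight K h d : (d < K)%N ->
  ((((l - 1)%:P + 'X) * geom F K) ^+ h)`_d = H_weight w h d.
Proof.
move=> lt_d; elim: h d lt_d => [|h IHh] d lt_d.
  by rewrite expr0 coef1.
set f := (X in X ^+ _) in IHh *.
have E : (1 - 'X) * f ^+ h.+1 = ((l - 1)%:P + 'X) * f ^+ h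
    + 'X^K * (- (((l - 1)%:P + 'X) * f ^+ h)).
  have Ef : (1 - 'X) * f = ((l - 1)%:P + 'X) * (1 - 'X^K).
    by rewrite -geomE /f; ring.
  by rewrite exprS mulrA Ef; ring.
elim: d lt_d => [|d IHd] lt_d; rewrite (coef_1subX lt_d E) mulrDl coefD coefCM coefXM.
  by rewrite IHh // !addr0.
by rewrite /= !IHh ?(ltnW lt_d) // IHd ?(ltnW lt_d) // !mul1r addrC addrA.
Qed.

(** With u = l / (1 - z), v = 1 - z and Y = z (l - 1 + z) / (1 - z), the left
    side is the coefficient of z^N in u^(j+1) + v^(j+1), which is a monic
    polynomial of degree j + 1 in Y.  Its constant term does not reach z^N,
    and the coefficient of z^N in Y^(k+1) is a weight of H-Delannoy paths. *)
Lemma entry_expansion (N j : nat) : (0 < N)%N ->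
  l ^+ j.+1 * gbinom (N%:R + j%:R) N%:Z + gbinom (N%:R - 2 - j%:R) N%:Z =
  \sum_(k < j.+1) (lucas l j.+1)`_k.+1 *
     (if (k < N)%N then H_weight w k.+1 (N - k.+1) else 0).
Proof.
move=> N_gt0; rewrite gbinom_nat gbinom_neg.
pose K := N.+1; have lt_N : (N < K)%N by [].
pose f := ((l - 1)%:P + 'X) * geom F K.
have gE := geomE F K.
have Muv : (l%:P * geom F K) * (1 - 'X) = l%:P * (1 - 'X^K) by rewrite -gE; ring.
have Euv : l%:P * geom F K + (1 - 'X) =
    'X * f + (l + 1)%:P + 'X^K * ((1 - 'X) - (l + 1)%:P).
  have -> : l%:P * geom F K + (1 - 'X) = 'X * f
     + ((1 - 'X) * geom F K) * ((l + 1)%:P - (1 - 'X)) + (1 - 'X).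
    by rewrite /f polyCB polyCD !polyC1; ring.
  by rewrite gE; ring.
have [e E] := lucas_power_sum j.+1 Euv Muv.
have := congr1 (fun p : {poly F} => p`_N) E; rewrite !coefD coefXnM lt_N addr0.
rewrite exprMn -polyC_exp coefCM coef_geomX // coef_1subX_exp.
have -> : 'C(N + j, j) = 'C(N + j, N) by rewrite -bin_sub ?leq_addl // addnK.
move=> ->.
pose t i := (lucas l j.+1)`_i * (('X * f) ^+ i)`_N.
have -> : (lucas l j.+1 \Po 'X * f)`_N = \sum_(i < j.+2) t i.
  rewrite coef_comp_poly (big_ord_widen _ t (size_lucas l j.+1)) big_mkcond.
  apply: eq_bigr => i _; case: ltnP => // le_i.
  by rewrite /t nth_default ?mul0r.
rewrite big_ord_recl {1}/t expr0 coef1 (gtn_eqF N_gt0) mulr0 add0r.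
apply: eq_bigr => k _; rewrite /t lift0 exprMn coefXnM; congr (_ * _).
rewrite ltnS ltnNge; case: (leqP N k) => // lt_k.
by rewrite (@coef_H_weight K) // /K ltnS leq_subr.
Qed.

(** By [entry_expansion] the two matrices differ by a unitriangular factor, the
    coefficients of the monic polynomials [lucas]. *)
Lemma det_binomials (n : nat) (N : 'I_n -> nat) :
    (forall i, (0 < N i)%N) ->
  \det (\matrix_(i, j) (l ^+ j.+1 * gbinom ((N i)%:R + j%:R) (N i)%:Z
                        + gbinom ((N i)%:R - 2 - j%:R) (N i)%:Z)) =
  \det (\matrix_(i, j < n)
    if (j < N i)%N then H_weight w j.+1 (N i - j.+1) else 0).
Proof.
move=> N_gt0; pose U : 'M[F]_n := \matrix_(j, k) (lucas l j.+1)`_k.+1.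
set M := (X in _ = \det X).
have -> : \matrix_(i, j < n) (l ^+ j.+1 * gbinom ((N i)%:R + j%:R) (N i)%:Z
      + gbinom ((N i)%:R - 2 - j%:R) (N i)%:Z) = M *m U^T.
  apply/matrixP=> i j; rewrite !mxE entry_expansion //.
  pose t k := (lucas l j.+1)`_k.+1 *
     (if (k < N i)%N then H_weight w k.+1 (N i - k.+1) else 0).
  rewrite (big_ord_widen n t) ?ltn_ord // big_mkcond /=.
  apply: eq_bigr => k _; rewrite !mxE /t mulrC; case: ltnP => // lt_k.
  by rewrite coef_lucas_gt ?mulr0 // ltnS.
have U_trig : is_trig_mx U.
  by apply/is_trig_mxP => i j lt_ij; rewrite mxE coef_lucas_gt ?ltnS.
rewrite det_mulmx det_tr (det_trig U_trig) [X in _ * X]big1 ?mulr1 // => i _.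
by rewrite mxE coef_lucas_lead.
Qed.
End Determinant.

(** * Tilings *)

Section PieceSums.
Variables (R : comNzRingType) (T : finType) (piece : pred {set T}).
Variable F : {set T} -> R.

Definition pieces (D : {set T}) (P : {set {set T}}) : bool :=
  partition P D && [forall d in P, piece d].

Definition pieces_sum (D : {set T}) : R :=
  \sum_(P | pieces D P) \prod_(d in P) F d.

Lemma pieces_sum0 : pieces_sum set0 = 1.
Proof.
rewrite /pieces_sum (big_pred1 set0) ?big_set0 // => P.
rewrite /pieces partition_set0 /=; case: eqP => //= ->.
by apply/forall_inP => d; rewrite inE.
Qed.

(** Some piece d must cover c; removing it leaves a tiling of the rest. *)
Lemma pieces_sum_expand (D : {set T}) (c : T) : c \in D ->
  pieces_sum D =
  \sum_(d | [&& piece d, c \in d & d \subset D]) F d * pieces_sum (D :\: d).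
Proof.
move=> Dc; rewrite /pieces_sum.
rewrite (partition_big (fun P : {set {set T}} => pblock P c)
  (fun d => [&& piece d, c \in d & d \subset D])) /=; last first.
  move=> P /andP[partP /forall_inP pieceP]; have coverP := cover_partition partP.
  have Pc : pblock P c \in P by rewrite pblock_mem // coverP.
  by rewrite pieceP // mem_pblock coverP Dc (partitionS partP).
apply: eq_bigr => d /and3P[piece_d dc sub_d]; rewrite big_distrr /=.
rewrite (reindex_onto (fun P : {set {set T}} => d |: P) (fun P => P :\ d)) /=; last first.
  move=> P /andP[/andP[partP _] /eqP <-].
  by rewrite setD1K // pblock_mem // (cover_partition partP).
have notin P : partition P (D :\: d) -> d \notin P.
  move=> partP; apply/negP => /(partitionS partP)/subsetP/(_ c dc).
  by rewrite inE dc.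
have d_neq0 : d != set0 by apply/set0Pn; exists c.
apply: eq_big => [P | P].
  apply/andP/idP => [[/andP[/andP[partP /forall_inP pieceP] _] /eqP eq_P] | ].
    apply/andP; split.
      rewrite -eq_P; apply: partitionD1 => //; exact: setU11.
    by apply/forall_inP => e Pe; apply: pieceP; rewrite inE Pe orbT.
  move=> /andP[partP /forall_inP pieceP]; split; last by rewrite setU1K ?notin.
  have partU : partition (d |: P) D.
    rewrite -[D](setID _ d) (setIidPr sub_d); apply: partitionU1 => //.
    by rewrite -setI_eq0 setDE setICA setICr setI0.
  apply/andP; split.
    rewrite /pieces partU; apply/forall_inP => e /setU1P[-> //|]; exact: pieceP.
  by apply/eqP/def_pblock; rewrite ?setU11 // (partition_trivIset partU).
move=> /andP[/andP[/andP[partP _] _] /eqP eq_P].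
rewrite big_setU1 ?notin // -eq_P; apply: partitionD1 => //; exact: setU11.
Qed.
End PieceSums.

Section Cells.
Variables (M N : nat).
Implicit Types (c d g w : cell M N).

(** Places the cells among the lattice points of the paths.  The gray cells of
    the diagonal 2h - 1 become points at height h, the white cells of the
    diagonal 2h - 2 too, with the indices shifted so that a gray cell and the
    white cell on its left are the same point.  A gray cell then says what the
    paths do at its point: dominoes D1, D2, D3 lead to the white cell reached by
    an east, north or northeast step, and a domino D4 leads back to the point
    itself, which no path visits. *)
Definition cell_point c : point :=
  ((c.1 : nat)%:Z - (uphalf c.2)%:Z, ((c.2)./2).+1%:Z).

Lemma cell_point_inj (c d : cell M N) : odd c.2 = odd d.2 -> cell_point c = cell_point d -> c = d.
Proof.
case: c d => [i k] [i' k'] /= odd_eq [] eq1 eq2.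
have eqk : k = k' by apply/val_inj => /=; move: eq2 odd_eq; lia.
by rewrite -eqk in eq1 *; congr pair; apply/val_inj => /=; lia.
Qed.

Lemma int_pairE (a b : point) : (a == b) = (a.1 == b.1) && (a.2 == b.2).
Proof. by []. Qed.

Lemma below_gray_white g w : gray g -> white w ->
  below g w = (cell_point w == move (cell_point g) East).
Proof. by rewrite /gray /white /below !int_pairE /= => *; apply/idP/idP; lia. Qed.

Lemma below_white_gray g w : gray g -> white w ->
  below w g = (cell_point w == move (cell_point g) North).
Proof. by rewrite /gray /white /below !int_pairE /= => *; apply/idP/idP; lia. Qed.

Lemma left_gray_white g w : gray g -> white w ->
  left_of g w = (cell_point w == move (cell_point g) NorthEast).
Proof. by rewrite /gray /white /left_of !int_pairE /= => *; apply/idP/idP; lia. Qed.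

Lemma left_white_gray g w : gray g -> white w ->
  left_of w g = (cell_point w == cell_point g).
Proof. by rewrite /gray /white /left_of !int_pairE /= => *; apply/idP/idP; lia. Qed.

Lemma adjacent_colors (u v : cell M N) : below u v || left_of u v -> gray u = white v.
Proof. by rewrite /gray /white /below /left_of !int_pairE /=; lia. Qed.

(** Reads off the two cells of a domino that is given as an unordered pair. *)
Lemma exists_pair (P : rel (cell M N)) (x y : cell M N) : x != y ->
  [exists u, exists v, ([set x; y] == [set u; v]) && P u v] = P x y || P y x.
Proof.
move=> neq_xy; apply/existsP/orP => [[u /existsP[v /andP[/eqP eq_xy Puv]]] | H].
  have : u \in [set x; y] by rewrite eq_xy set21.
  have : v \in [set x; y] by rewrite eq_xy set22.
  have : x \in [set u; v] by rewrite -eq_xy set21.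
  have : y \in [set u; v] by rewrite -eq_xy set22.
  rewrite !inE => /orP[]/eqP ? /orP[]/eqP ? /orP[]/eqP ? /orP[]/eqP ?; subst;
    by [left | right | rewrite eqxx in neq_xy].
case: H => H; first by exists x; apply/existsP; exists y; rewrite eqxx.
by exists y; apply/existsP; exists x; rewrite setUC eqxx.
Qed.

Lemma existsb_step (P : pred step) :
  [exists t, P t] = [|| P East, P North | P NorthEast].
Proof.
apply/existsP/or3P => [[t]|].
  by case: t => Pt; [apply: Or31 | apply: Or32 | apply: Or33].
by case=> Pt; [exists East | exists North | exists NorthEast].
Qed.

Lemma gray_white_neq g w : gray g -> white w -> g != w.
Proof. by rewrite /gray /white => gray_g; apply: contraNneq => <-. Qed.

Lemma domino_gray_white g w : gray g -> white w ->
  domino [set g; w] = (cell_point w == cell_point g) ||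
    [exists t, cell_point w == move (cell_point g) t].
Proof.
move=> gray_g white_w; rewrite /domino existsb_step.
rewrite (exists_pair (fun u v => below u v || left_of u v)) ?gray_white_neq //.
rewrite below_gray_white // below_white_gray // left_gray_white // left_white_gray //.
do 4!case: (cell_point w == _) => //=.
Qed.

Lemma dominoP (d : {set cell M N}) c : domino d -> c \in d ->
  exists2 e, d = [set c; e] & gray e = white c.
Proof.
move=> /existsP[u /existsP[v /andP[/eqP -> adj_uv]]].
have eq_uv := adjacent_colors adj_uv.
rewrite !inE => /orP[]/eqP ->; first exists v => //.
  by move: eq_uv; rewrite /gray /white => ->; rewrite negbK.
by exists u => //; rewrite setUC.
Qed.

Section Weight.
Variables (R : comNzRingType) (wt : step -> R).

Definition domino_weight (d : {set cell M N}) : R :=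
  (if domino_D1 d then wt East else 1) * (if domino_D2 d then wt North else 1) *
  (if domino_D3 d then wt NorthEast else 1).

Lemma domino_weightE g w : gray g -> white w ->
  domino_weight [set g; w] =
  (if cell_point w == move (cell_point g) East then wt East else 1) *
  (if cell_point w == move (cell_point g) North then wt North else 1) *
  (if cell_point w == move (cell_point g) NorthEast then wt NorthEast else 1).
Proof.
move=> gray_g white_w; have neq_gw := gray_white_neq gray_g white_w.
have white_g : white g = false by apply: negbTE; rewrite negbK.
have gray_w : gray w = false by apply: negbTE.
rewrite /domino_weight /domino_D1 /domino_D2 /domino_D3.
rewrite (exists_pair (fun b t => below b t && (gray b && white t))) //.
rewrite (exists_pair (fun b t => below b t && (white b && gray t))) //.
rewrite (exists_pair (fun u v => left_of u v && (gray u && white v))) //.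
rewrite gray_g white_g gray_w white_w !andbT !andbF !orbF /=.
by rewrite below_gray_white // below_white_gray // left_gray_white.
Qed.

Lemma domino_weight_step g w t : gray g -> white w ->
  cell_point w = move (cell_point g) t -> domino_weight [set g; w] = wt t.
Proof.
move=> gray_g white_w eq_w; rewrite domino_weightE // eq_w.
move: (cell_point g) => [x y]; case: t {eq_w}; rewrite !int_pairE /= !eqxx.
- have -> : (x + 1 == x) = false by lia.
  have -> : (y == y + 1) = false by lia.
  by rewrite !mulr1.
- have -> : (x == x + 1) = false by lia.
  by rewrite !mulr1 mul1r.
have -> : (x + 1 == x) = false by lia.
have -> : (y + 1 == y) = false by lia.
by rewrite !mul1r.
Qed.

Lemma domino_weight_stay g w : gray g -> white w ->
  cell_point w = cell_point g -> domino_weight [set g; w] = 1.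
Proof.
move=> gray_g white_w eq_w; rewrite domino_weightE // eq_w.
move: (cell_point g) => [x y]; rewrite !int_pairE /= !eqxx.
have -> : (x == x + 1) = false by lia.
have -> : (y == y + 1) = false by lia.
by rewrite !mulr1.
Qed.

(** Expansion over the partners of c, which have the other color. *)
Lemma tiling_expand (D : {set cell M N}) c : c \in D ->
  pieces_sum (@domino M N) domino_weight D =
  \sum_(e | [&& e \in D, gray e == white c & domino [set c; e]])
    domino_weight [set c; e] *
    pieces_sum (@domino M N) domino_weight (D :\: [set c; e]).
Proof.
move=> Dc; rewrite (pieces_sum_expand _ _ Dc).
pose A := [set e | [&& e \in D, gray e == white c & domino [set c; e]]].
rewrite (eq_bigl (mem [set [set c; e] | e in A])); last first.
  move=> d; apply/and3P/imsetP => [[dom_d cd sub_d] | [e]].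
    have [e eq_d col_e] := dominoP dom_d cd; exists e => //.
    rewrite inE col_e eqxx -eq_d dom_d /= andbT.
    by apply: (subsetP sub_d); rewrite eq_d set22.
  rewrite inE => /and3P[De _ dom_e] ->.
  by rewrite dom_e set21 subUset !sub1set Dc De.
rewrite big_imset /=; first by apply: eq_bigl => e; rewrite inE.
move=> e e'; rewrite !inE => /and3P[_ /eqP col_e _] _ eq_ee'.
have : e \in [set c; e'] by rewrite -eq_ee' set22.
rewrite !inE => /orP[]/eqP // eq_ec.
by move: col_e; rewrite eq_ec /white /gray; case: odd.
Qed.
End Weight.

End Cells.

(** * The cells of the Type 2 domain *)

(** The r-th bullet, r counted from 0, comes after r bullets and
    [nth 0 mu r - x] circles. *)
Lemma boundary_wordP (x : nat) (mu : seq nat) (i : nat) : path leq x mu ->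
  reflect (exists2 r, (r < size mu)%N & (i + x = nth 0 mu r + r)%N)
    (nth circle (boundary_word x mu) i == bullet).
Proof.
elim: mu x i => [|y mu IH] x i /=; first by rewrite nth_nil => _; constructor; case.
move=> /andP[le_xy path_mu]; rewrite nth_cat size_nseq.
have ge_y r : (r < size mu)%N -> (y <= nth 0 mu r)%N.
  move=> lt_r; have := order_path_min leq_trans path_mu.
  by move=> /allP; apply; exact: mem_nth.
case: (ltnP i (y - x)) => [lt_i | le_i].
  rewrite nth_nseq lt_i; constructor => -[[|r] /=]; first by lia.
  by rewrite ltnS => /ge_y; lia.
case E : (i - (y - x))%N => [|i'] /=.
  by constructor; exists 0%N => //=; lia.
apply: (iffP (IH y i' path_mu)) => [[r lt_r eq_r] | [[|r] /= lt_r eq_r]].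
- by exists r.+1 => //=; lia.
- by lia.
- by exists r => //; lia.
Qed.

Lemma tnth_partition (n : nat) (lam : n.-tuple nat) (i k : 'I_n) :
  is_partition lam -> (i <= k)%N -> (tnth lam k <= tnth lam i)%N.
Proof.
move=> lam_part le_ik; rewrite !(tnth_nth 0%N).
have tr : transitive geq by move=> y x z; rewrite /geq /= => /[swap]; apply: leq_trans.
have rf : reflexive geq by move=> x; apply: leqnn.
by apply: (sorted_leq_nth tr rf 0%N lam_part); rewrite ?inE ?size_tuple.
Qed.

Lemma tnth_first_part (n : nat) (lam : n.-tuple nat) (i : 'I_n) :
  is_partition lam -> (tnth lam i <= first_part lam)%N.
Proof.
move=> lam_part; have n_gt0 : (0 < n)%N := leq_ltn_trans (leq0n i) (ltn_ord i).
have := @tnth_partition _ _ (Ordinal n_gt0) i lam_part (leq0n i).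
by rewrite [tnth lam (Ordinal _)](tnth_nth 0%N) nth0.
Qed.

Lemma bulletP (n : nat) (lam : n.-tuple nat) (i : nat) : is_partition lam ->
  reflect (exists j : 'I_n, i = (tnth lam j + (n - j.+1))%N)
    (nth circle (boundary_encoding lam) i == bullet).
Proof.
move=> lam_part; apply: (iffP (boundary_wordP _ _)).
- rewrite -[path leq 0 (rev lam)]/(sorted leq (0%N :: rev lam)) /=.
  rewrite path_min_sorted; last by apply/allP.
  by rewrite rev_sorted.
- move=> [r]; rewrite size_rev size_tuple => lt_r.
  rewrite nth_rev ?size_tuple // addn0 => ->.
  have lt_j : (n - r.+1 < n)%N by lia.
  by exists (Ordinal lt_j); rewrite (tnth_nth 0%N) /=; congr addn; lia.
- move=> [j ->]; have lt_j := ltn_ord j; exists (n - j.+1)%N.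
    by rewrite size_rev size_tuple; lia.
  rewrite nth_rev ?size_tuple ?addn0; last by lia.
  by rewrite (tnth_nth 0%N); congr (nth _ _ _ + _)%N; lia.
Qed.

Section Sweep.
Variables (R : comNzRingType) (wt : step -> R) (n : nat) (lam : n.-tuple nat).
Hypothesis lam_part : is_partition lam.
Variable B : nat.

Notation M := (first_part lam).
Notation N := (2 * n)%N.
Notation cell := (cell M N).
Notation goal := (path_end lam).
Implicit Types (c g x : cell) (q r : point) (u : 'I_n -> point) (S : seq point).

(** The points carried by gray cells: all places below the final height where
    the paths can be. *)
Definition region q : bool := [&& 1 <= q.2, q.2 <= n%:Z, - q.2 <= q.1 & q.1 < M%:Z].

Lemma goal_inj : injective goal.
Proof.
have lt_goal (i k : 'I_n) : (i < k)%N -> (goal k).1 < (goal i).1.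
  by move=> lt_ik; have := tnth_partition lam_part (ltnW lt_ik); rewrite /=; lia.
move=> i k eq_ik; apply/val_inj => /=; case: (ltngtP i k) => // /lt_goal;
  by rewrite eq_ik ltxx.
Qed.

Lemma goal_staggered : staggered goal.
Proof.
move=> i k lt_ik; have := tnth_partition lam_part (ltnW lt_ik); rewrite /=.
by split=> //; lia.
Qed.

Lemma goal_lt i : (goal i).1 < M%:Z.
Proof. by have := tnth_first_part i lam_part; rewrite /=; lia. Qed.

Lemma region_type2 c : (val c.2 < N)%N ->
  (c \in type2_domain lam) = ((cell_point c).1 < M%:Z).
Proof.
by move=> lt_c; rewrite !inE ltn_eqF //= andbT; apply/idP/idP; lia.
Qed.

Lemma gray_lt c : gray c -> (val c.2 < N)%N.
Proof. by rewrite /gray; have := ltn_ord c.2; rewrite /=; lia. Qed.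

Lemma gray_region c : gray c ->
  (c \in type2_domain lam) = region (cell_point c).
Proof.
move=> gray_c; rewrite (region_type2 (gray_lt gray_c)) /region /=.
have := gray_lt gray_c; move: gray_c; rewrite /gray /=.
by move=> *; apply/idP/idP; lia.
Qed.

Lemma exists_gray q : region q ->
  exists2 g, gray g & (g \in type2_domain lam) && (cell_point g == q).
Proof.
case: q => [x h] reg_q; have := reg_q; rewrite /region /= => /and4P[h1 hn hx xM].
have lt_i : (absz (x + h)%R < M + uphalf N)%N by lia.
have lt_k : (absz (h + h - 1)%R < N.+1)%N by lia.
pose g : cell := (Ordinal lt_i, Ordinal lt_k).
have gray_g : gray g by rewrite /gray /=; lia.
have pt_g : cell_point g = (x, h) by rewrite /cell_point /=; congr pair; lia.
by exists g => //; rewrite gray_region // pt_g reg_q eqxx.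
Qed.

Lemma exists_white q : region q -> - q.2 != q.1 ->
  exists2 x, white x & [&& x \in type2_domain lam, cell_point x == q & (val x.2 < N)%N].
Proof.
case: q => [x h]; rewrite /region /= => /and4P[h1 hn hx xM] neq_x.
have lt_i : (absz (x + h - 1)%R < M + uphalf N)%N by lia.
have lt_k : (absz (h + h - 2)%R < N.+1)%N by lia.
pose g : cell := (Ordinal lt_i, Ordinal lt_k).
have lt_g : (val g.2 < N)%N by rewrite /=; lia.
have pt_g : cell_point g = (x, h) by rewrite /cell_point /=; congr pair; lia.
exists g; first by rewrite /white /=; lia.
by rewrite region_type2 // lt_g pt_g xM eqxx.
Qed.

(** The bullets of the last diagonal are the end points of the paths. *)
Lemma top_goal c : (val c.2 == N) ->
  (c \in type2_domain lam) = [exists j, cell_point c == goal j].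
Proof.
move=> top_c; rewrite !inE top_c implyTb.
have goalE j : (cell_point c == goal j) = ((c.1 : nat) == (tnth lam j + (n - j.+1))%N).
  by rewrite int_pairE /=; have := ltn_ord j; move: top_c => /=; lia.
apply/andP/existsP => [[_ /(bulletP _ lam_part)[j eq_j]] | [j]].
  by exists j; rewrite goalE eq_j.
rewrite goalE => /eqP eq_j; split; last by apply/(bulletP _ lam_part); exists j.
have := tnth_first_part j lam_part; have := ltn_ord j.
by rewrite eq_j; move: top_c => /=; lia.
Qed.

Lemma exists_goal j :
  exists2 x, white x & [&& x \in type2_domain lam, cell_point x == goal j & (val x.2 == N)].
Proof.
have le_j := tnth_first_part j lam_part; have lt_j := ltn_ord j.
have lt_i : (tnth lam j + (n - j.+1) < M + uphalf N)%N by lia.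
have lt_k : (N < N.+1)%N by [].
pose g : cell := (Ordinal lt_i, Ordinal lt_k).
have top_g : (val g.2 == N) by [].
have pt_g : cell_point g = goal j by rewrite /cell_point /path_end /=; congr pair; lia.
exists g; first by rewrite /white /=; lia.
by rewrite top_goal // pt_g eqxx top_g !andbT; apply/existsP; exists j.
Qed.

(** What is left of the domain when the points of [S] have yet to be treated and
    the paths have reached the heads [u].  A head has no white cell: a starting
    point never had one, and any other was used up by the step that led there. *)
Definition sweep_domain S u : {set cell} :=
  [set c in type2_domain lam | if gray c then cell_point c \in S else
     (cell_point c \notin codom u) && ((cell_point c \in S) || (val c.2 == N))].

Lemma gray_sweep S u g : gray g ->
  (g \in sweep_domain S u) = (g \in type2_domain lam) && (cell_point g \in S).
Proof. by move=> gray_g; rewrite inE gray_g. Qed.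

Lemma white_sweep S u x : white x ->
  (x \in sweep_domain S u) = [&& x \in type2_domain lam, cell_point x \notin codom u
    & (cell_point x \in S) || (val x.2 == N)].
Proof. by move=> /negbTE white_x; rewrite inE /gray white_x. Qed.

(** * Sweeping the domain along the antidiagonals *)

(** The invariant of the sweep.  The points of [S] come by increasing rank and
    include all points of higher rank ([sweep_later]), so that the first one is
    a front head if it is a head at all.  A starting point has no white cell;
    [sweep_starts] says that those left in [S] are heads. *)
Record sweep_state S u : Prop := SweepState {
  sweep_region : {in S, forall q, region q};
  sweep_uniq : uniq S;
  sweep_sorted : pairwise (fun q r => rank q <= rank r) S;
  sweep_later : {in S, forall q r, region r -> rank q < rank r -> r \in S};
  sweep_heads : forall i, (u i).2 <= n%:Z -> u i \in S;
  sweep_starts : {in S, forall q, - q.2 = q.1 -> q \in codom u};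
  sweep_inj : injective u;
  sweep_stag : staggered u;
  sweep_top : forall i, (u i).2 <= n.+1%:Z;
  sweep_size : forall i, (goal i).1 - (u i).1 + ((goal i).2 - (u i).2) <= B%:Z
}.

Let tilings := pieces_sum (@domino M N) (domino_weight wt).

(** Only the white cells of goals that no head has reached are left, and they
    can be tiled only if there are none. *)
Lemma sweep_nil u : sweep_state [::] u ->
  tilings (sweep_domain [::] u) = routes_sum wt B goal u.
Proof.
case=> _ _ _ _ heads _ u_inj u_stag u_top _.
have {}u_top i : (u i).2 = n.+1%:Z.
  have : ~~ ((u i).2 <= n%:Z) by apply/negP => /heads; rewrite in_nil.
  by have := u_top i; lia.
have [/forallP covered | /forallPn[k k_free]] := boolP [forall k, goal k \in codom u].
  have eq_u : goal =1 u.
    apply: (@staggered_eq n n.+1%:Z) => //; [exact: goal_inj | exact: goal_staggered |].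
    by move=> i; have /codomP := covered i.
  rewrite routes_sum_arrived //; last exact: goal_inj.
  suff -> : sweep_domain [::] u = set0 by rewrite /tilings pieces_sum0.
  apply/setP=> c; rewrite !in_set0; apply/negbTE; rewrite inE negb_and orbC.
  case: ifP => //= _; rewrite -implybE; apply/implyP => /andP[free_c top_c].
  rewrite top_goal //; apply/existsPn => j; apply: contraNneq free_c => ->.
  exact: covered.
have [j neq_j] : exists j, u j != goal j.
  apply/existsP; apply: contraNT k_free => /existsPn eq_u.
  by have /negPn/eqP <- := eq_u k; exact: codom_f.
rewrite (@routes_sum_dead_end _ _ _ _ _ _ j) ?u_top //.
have [x white_x /and3P[dom_x /eqP pt_x top_x]] := exists_goal k.
have Dx : x \in sweep_domain [::] u by rewrite white_sweep // dom_x pt_x k_free top_x orbT.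
rewrite /tilings (tiling_expand _ Dx) big1 // => e /and3P[De /eqP gray_e _].
by move: De; rewrite gray_sweep ?gray_e //= andbF.
Qed.

(** The white cell at [q] can only be matched with the gray cell at [q], since
    the other gray cells next to it have smaller rank and are gone. *)
Lemma sweep_unvisited q S u :
    sweep_state (q :: S) u -> q \notin codom u ->
  sweep_state S u /\ tilings (sweep_domain (q :: S) u) = tilings (sweep_domain S u).
Proof.
case=> reg /= /andP[notin_q uniq_S] /andP[/allP min_q sorted_S] later heads starts
  u_inj u_stag u_top u_size free_q.
split.
  split=> //.
  - by move=> r Sr; apply: reg; rewrite inE Sr orbT.
  - move=> r Sr p reg_p lt_rp; have Sqr : r \in q :: S by rewrite inE Sr orbT.
    have := later r Sqr p reg_p lt_rp; rewrite inE => /orP[/eqP eq_p|//].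
    by have := min_q _ Sr; rewrite /= leNgt -eq_p lt_rp.
  - move=> i /heads; rewrite inE => /orP[/eqP eq_q|//].
    by case/negP: free_q; rewrite -eq_q; exact: codom_f.
  - by move=> r Sr; apply: starts; rewrite inE Sr orbT.
have reg_q : region q by apply: reg; exact: mem_head.
have [g gray_g /andP[dom_g /eqP pt_g]] := exists_gray reg_q.
have not_start : - q.2 != q.1.
  by apply: contraNneq free_q => /(starts _ (mem_head _ _)).
have [x white_x /and3P[dom_x /eqP pt_x lt_x]] := exists_white reg_q not_start.
have Dx : x \in sweep_domain (q :: S) u.
  by rewrite white_sweep // dom_x pt_x free_q mem_head.
rewrite /tilings (tiling_expand _ Dx) (big_pred1 g); last first.
  move=> h; apply/and3P/eqP => [[Dh /eqP gray_h] | ->]; last first.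
    split; first by rewrite gray_sweep // dom_g pt_g mem_head.
      by rewrite gray_g white_x.
    by rewrite setUC domino_gray_white // pt_x pt_g eqxx.
  rewrite white_x in gray_h; rewrite setUC domino_gray_white // => adj.
  apply: cell_point_inj; first by rewrite -!/(gray _) gray_h gray_g.
  case/orP: adj => [/eqP <- | /existsP[t /eqP eq_x]]; first by rewrite pt_x pt_g.
  have lt_r : rank (cell_point h) < rank q.
    by have := rank_move (cell_point h) t; rewrite -eq_x pt_x lezD1.
  move: Dh; rewrite gray_sweep // inE => /andP[_ /orP[/eqP eq_h | Sh]].
    by rewrite eq_h ltxx in lt_r.
  by have := min_q _ Sh; rewrite /= leNgt lt_r.
rewrite setUC domino_weight_stay ?pt_x ?pt_g // mul1r; congr pieces_sum.
apply/setP => c; rewrite in_setD in_set2 negb_or.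
case: (boolP (gray c)) => col_c.
  rewrite !gray_sweep // in_cons; have -> : c != x by apply: gray_white_neq.
  rewrite andbT; case: (eqVneq c g) => [->|neq_g] /=.
    by rewrite pt_g (negPf notin_q) andbF.
  have -> // : (cell_point c == q) = false.
  apply/negbTE; apply: contraNneq neq_g => eq_c; apply/eqP; apply: cell_point_inj.
    by rewrite -!/(gray _) col_c gray_g.
  by rewrite eq_c pt_g.
rewrite !white_sweep // in_cons; have -> /= : c != g by rewrite eq_sym gray_white_neq.
case: (eqVneq c x) => [->|neq_x] /=.
  by rewrite pt_x (negPf notin_q) (ltn_eqF lt_x) !andbF.
have -> // : (cell_point c == q) = false.
apply/negbTE; apply: contraNneq neq_x => eq_c; apply/eqP; apply: cell_point_inj.
  by move: col_c white_x; rewrite /white /gray => /negbTE -> /negbTE ->.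
by rewrite eq_c pt_x.
Qed.

(** The white cell at the head [u i] is gone, so the gray cell there is covered
    by one of the three dominoes that stand for a step.  A step without a
    matching domino either hits another head, or leaves the domain to the east,
    or stops beside the goals, and then no route continues it. *)
Lemma sweep_visited i S u :
    (forall u', sweep_state S u' ->
       tilings (sweep_domain S u') = routes_sum wt B goal u') ->
    sweep_state (u i :: S) u ->
  tilings (sweep_domain (u i :: S) u) = routes_sum wt B goal u.
Proof.
move=> IH [reg /= /andP[notin_q uniq_S] /andP[/allP min_q sorted_S] later heads starts
  u_inj u_stag u_top u_size].
have reg_q : region (u i) by apply: reg; exact: mem_head.
have [lvl1 lvln left_q right_q] : [/\ 1 <= (u i).2, (u i).2 <= n%:Z,
    - (u i).2 <= (u i).1 & (u i).1 < M%:Z] by apply/and4P.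
have fr_i : front n.+1%:Z u i.
  split=> [|k lt_k]; first by clear -lvln; lia.
  have : u k \in u i :: S by apply: heads; clear -lt_k; lia.
  by rewrite inE => /orP[/eqP -> // | /min_q].
have lt_goal : (u i).2 < (goal i).2 by rewrite /=; lia.
have unreach j := front_unreachable (k := j) u_inj fr_i.
rewrite (routes_sum_step wt lt_goal unreach (u_size i)).
have [g gray_g /andP[dom_g /eqP pt_g]] := exists_gray reg_q.
have Dg : g \in sweep_domain (u i :: S) u by rewrite gray_sweep // dom_g pt_g mem_head.
rewrite /tilings (tiling_expand _ Dg).
(* Sort the partners of [g] by the step they stand for. *)
pose dir x := odflt East [pick t | cell_point x == move (u i) t].
rewrite (partition_big dir xpredT) //=; apply: eq_bigr => t _.
pose Q x := [&& x \in sweep_domain (u i :: S) u, white x & cell_point x == move (u i) t].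
rewrite (eq_bigl Q) => [|x]; last first.
  rewrite /Q /dir; case Dx: (x \in _) => //=.
  have -> : (gray x == white g) = white x.
    by move: gray_g; rewrite /white /gray => ->; case: odd.
  case white_x : (white x) => //=.
  rewrite domino_gray_white // pt_g; move: Dx; rewrite white_sweep // => /and3P[_ free_x _].
  have -> /= : (cell_point x == u i) = false.
    by apply/negbTE; apply: contraNneq free_x => ->; exact: codom_f.
  case: pickP => [t' /= /eqP eq_x | none].
    rewrite eq_x; have -> /= : [exists t, move (u i) t' == move (u i) t].
      by apply/existsP; exists t'.
    by apply/eqP/eqP => [-> | /move_inj].
  rewrite none; apply/negbTE; rewrite negb_and; apply/orP; left.
  by apply/existsPn => t'; rewrite none.
pose q' := move (u i) t; pose u' := replace_at u i q'.
have u'_i : u' i = q' by rewrite /u' /replace_at eqxx.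
have u'_neq j : j != i -> u' j = u j by rewrite /u' /replace_at => /negPf ->.
have [/existsP[j /andP[neq_ji /eqP eq_j]] | /existsPn miss] :=
    boolP [exists j, (j != i) && (u j == q')].
  rewrite (routes_sum_collision _ _ _ neq_ji) -/u' ?u'_i ?u'_neq // mulr0 big1 // => x.
  case/and3P=> + white_x /eqP pt_x; rewrite white_sweep // pt_x => /and3P[_ + _].
  by rewrite -/q' -eq_j codom_f.
have {}miss j : j != i -> u j != q' by move=> neq_j; have := miss j; rewrite neq_j.
have rank_q' := rank_move (u i) t; rewrite -/q' in rank_q'.
have neq_q' : q' != u i by apply: contraTneq rank_q' => ->; rewrite lezD1 ltxx.
have free_q' : q' \notin codom u.
  apply/negP => /codomP[j eq_j]; case: (eqVneq j i) => [eq_ji|/miss].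
    by rewrite eq_j eq_ji eqxx in neq_q'.
  by rewrite eq_j eqxx.
have top_q' : q'.2 <= n.+1%:Z by have := front_ge t fr_i u_top i; rewrite -/u' u'_i.
have [le1 le2] := move_le (u i) t; rewrite -/q' in le1 le2.
have [x Qx | noQ] := pickP Q; last first.
  rewrite big_pred0 // -/u'.
  have [le_q' | gt_q'] := boolP (q'.2 <= n%:Z).
    have q'_out : M%:Z <= q'.1.
      rewrite leNgt; apply/negP => lt_q'.
      have reg_q' : region q'.
        clear -lvl1 left_q lt_q' le1 le2 le_q'; clearbody q'; rewrite /region.
        by case: (u i) lvl1 left_q le1 le2 => a b /=; case: q' lt_q' le_q' => c d /=; lia.
      have Sq' : q' \in u i :: S.
        by apply: (later (u i) (mem_head _ _) q' reg_q'); rewrite -lezD1.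
      have not_start : - q'.2 != q'.1.
        by apply: contraNneq free_q' => /(starts _ Sq').
      have [x white_x /and3P[dom_x pt_x lt_x]] := exists_white reg_q' not_start.
      have := noQ x; rewrite /Q white_x pt_x white_sweep // dom_x (eqP pt_x).
      by rewrite free_q' Sq'.
    rewrite (@routes_sum_overshoot _ _ _ _ _ _ i) ?mulr0 // u'_i.
    exact: lt_le_trans (goal_lt i) q'_out.
  have {}top_q' : q'.2 = n.+1%:Z by clear -top_q' gt_q'; lia.
  rewrite (@routes_sum_dead_end _ _ _ _ _ _ i) ?mulr0 ?u'_i //.
  apply/negP => /eqP eq_goal.
  have [x white_x /and3P[dom_x pt_x top_x]] := exists_goal i.
  have := noQ x; rewrite /Q white_x white_sweep // dom_x (eqP pt_x) -eq_goal.
  by rewrite free_q' top_x orbT eqxx.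
have /and3P[Dx white_x /eqP pt_x] := Qx; rewrite -/q' in pt_x.
rewrite (big_pred1 x); last first.
  move=> y; apply/idP/eqP => [/and3P[_ white_y /eqP pt_y] | -> //].
  apply: cell_point_inj; last by rewrite pt_x pt_y.
  by move: white_x white_y; rewrite /white => /negbTE -> /negbTE ->.
rewrite (domino_weight_step _ (t := t)) ?pt_g //; congr (_ * _).
have Sq' : q'.2 <= n%:Z -> q' \in S.
  move=> le_q'; move: Dx; rewrite white_sweep // pt_x in_cons (negPf neq_q') /=.
  case/and3P=> _ _ /orP[// | /= top_x].
  move: pt_x; rewrite /cell_point => eq_q'; clear -le_q' eq_q' top_x.
  by move: le_q'; rewrite -eq_q' /=; lia.
rewrite -[RHS]IH /tilings; last first.
  split=> //.
  - by move=> r Sr; apply: reg; rewrite inE Sr orbT.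
  - move=> r Sr p reg_p lt_rp; have Sqr : r \in u i :: S by rewrite inE Sr orbT.
    have := later r Sqr p reg_p lt_rp; rewrite inE => /orP[/eqP eq_p|//].
    by have := min_q _ Sr; rewrite /= leNgt -eq_p lt_rp.
  - move=> j; case: (eqVneq j i) => [->|neq_j]; first by rewrite -/u' u'_i.
    rewrite -/u' u'_neq // => /heads; rewrite inE (inj_eq u_inj).
    by rewrite (negPf neq_j).
  - move=> r Sr eq_r; have /codomP[j eq_j] : r \in codom u.
      by apply: starts; rewrite // inE Sr orbT.
    have neq_j : j != i by apply: contraNneq notin_q => <-; rewrite -eq_j.
    by rewrite eq_j -(u'_neq _ neq_j); exact: codom_f.
  - exact: replace_at_inj.
  - exact: staggered_move fr_i.
  - exact: front_ge.
  - move=> j; have := u_size j; rewrite -/u'; case: (eqVneq j i) => [->|neq_j].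
      rewrite u'_i; clear -rank_q'; clearbody q'; move: rank_q'.
      by case: (u i) => c d; case: q' => e f; rewrite /rank /=; lia.
    by rewrite u'_neq.
congr pieces_sum; apply/setP => c; rewrite in_setD in_set2 negb_or -/u'.
case: (boolP (gray c)) => col_c.
  rewrite !gray_sweep // in_cons; have -> : c != x by apply: gray_white_neq.
  rewrite andbT; case: (eqVneq c g) => [->|neq_g] /=.
    by rewrite pt_g (negPf notin_q) andbF.
  have -> // : (cell_point c == u i) = false.
  apply/negbTE; apply: contraNneq neq_g => eq_c; apply/eqP; apply: cell_point_inj.
    by rewrite -!/(gray _) col_c gray_g.
  by rewrite eq_c pt_g.
rewrite !white_sweep //; have -> /= : c != g by rewrite eq_sym gray_white_neq.
case: (eqVneq c x) => [->|neq_x] /=.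
  have -> : cell_point x \in codom u' by rewrite pt_x -u'_i codom_f.
  by rewrite andbF.
have neq_pt : cell_point c != q'.
  apply: contraNneq neq_x => eq_c; apply/eqP; apply: cell_point_inj.
    by move: col_c white_x; rewrite /white /gray => /negbTE -> /negbTE ->.
  by rewrite eq_c pt_x.
case: (boolP (c \in type2_domain lam)) => //= dom_c.
apply/andP/andP => [[free_c Sc] | [free_c Sc]]; split.
- apply/negP => /codomP[j]; case: (eqVneq j i) => [->|neq_j].
    by rewrite u'_i => eq_c; rewrite eq_c eqxx in neq_pt.
  by rewrite u'_neq // => eq_c; rewrite eq_c codom_f in free_c.
- move: Sc; rewrite inE; case: eqP => // eq_c.
  by rewrite eq_c codom_f in free_c.
- apply/negP => /codomP[j]; case: (eqVneq j i) => [->|neq_j] eq_c.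
    case/orP: Sc => [|/= top_c]; first by rewrite eq_c (negPf notin_q).
    by clear -lvln eq_c top_c; move: lvln; rewrite -eq_c /=; lia.
  by rewrite eq_c -(u'_neq _ neq_j) codom_f in free_c.
by case/orP: Sc => [Sc | ->]; rewrite ?orbT // inE Sc orbT.
Qed.

Lemma sweepE S u : sweep_state S u ->
  tilings (sweep_domain S u) = routes_sum wt B goal u.
Proof.
elim: S u => [|q S IH] u state_u; first exact: sweep_nil.
have [/codomP[i eq_q] | free_q] := boolP (q \in codom u).
  by rewrite eq_q in state_u *; exact: sweep_visited.
by have [/IH <- ->] := sweep_unvisited state_u free_q.
Qed.

Lemma sweep_start : (M + n <= B)%N -> exists2 S, sweep_state S (@path_start n)
  & sweep_domain S (@path_start n) = type2_domain lam.
Proof.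
move=> le_B; pose le_rank q r := rank q <= rank r.
pose S := sort le_rank [seq cell_point c | c <- enum [set c in type2_domain lam | gray c]].
have memS q : (q \in S) = region q.
  rewrite mem_sort; apply/mapP/idP => [[c] | /exists_gray[g gray_g /andP[dom_g /eqP <-]]].
    by rewrite mem_enum inE => /andP[dom_c gray_c] ->; rewrite -gray_region.
  by exists g; rewrite // mem_enum inE dom_g.
have startE q : - q.2 = q.1 -> region q -> q \in codom (@path_start n).
  case: q => [x h] /= <- /and4P[/= h1 hn _ _].
  have lt_j : (absz (h - 1)%R < n)%N by lia.
  have -> : (- h, h) = path_start (Ordinal lt_j) by rewrite /path_start /=; congr pair; lia.
  exact: codom_f.
exists S.
  split.
  - by move=> q; rewrite memS.
  - rewrite sort_uniq map_inj_in_uniq ?enum_uniq // => c d.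
    rewrite !mem_enum !inE => /andP[_ gray_c] /andP[_ gray_d].
    by apply: cell_point_inj; rewrite -!/(gray _) gray_c gray_d.
  - rewrite -sorted_pairwise; last by move=> ? ? ?; exact: le_trans.
    by apply: sort_sorted => ? ?; exact: le_total.
  - by move=> q _ r reg_r _; rewrite memS.
  - by move=> i _; rewrite memS /region /=; have := ltn_ord i; lia.
  - by move=> q; rewrite memS => reg_q eq_q; exact: startE.
  - by move=> i j [_ ?]; apply/val_inj.
  - by move=> i k lt_ik /=; split; lia.
  - by move=> i /=; have := ltn_ord i; lia.
  - by move=> i /=; have := tnth_first_part i lam_part; have := ltn_ord i; lia.
apply/setP=> c; case: (boolP (gray c)) => col_c.
  by rewrite gray_sweep // memS gray_region // andbb.
rewrite white_sweep //; case dom_c : (c \in _) => //=; apply/andP; split.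
  by apply/negP => /codomP[j]; rewrite /cell_point /path_start => -[]; move: col_c; rewrite /gray; lia.
have [top_c | not_top] := boolP (val c.2 == N); first by rewrite orbT.
have lt_c : (val c.2 < N)%N by rewrite ltn_neqAle not_top -ltnS; exact: ltn_ord.
rewrite orbF memS; move: dom_c; rewrite region_type2 // /region /=.
by move: lt_c => /= lt_c lt_M; clear -lt_c lt_M; lia.
Qed.

End Sweep.

(** * Tilings, paths and determinants *)

Lemma tiling_weightE (R : comNzRingType) (w1 w2 w3 : R) (M N : nat)
    (T : {set {set cell M N}}) :
  tiling_weight w1 w2 w3 T =
  \prod_(d in T) domino_weight (step_weight w1 w2 w3) d.
Proof.
have prod_if (P : pred {set cell M N}) (x : R) :
    \prod_(d in T) (if P d then x else 1) = x ^+ #|[set d in T | P d]|.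
  by rewrite -big_mkcondr -prodr_const; apply: eq_bigl => d; rewrite inE.
by rewrite !big_split /= !prod_if.
Qed.

Lemma system_weightE (R : comNzRingType) (w1 w2 w3 : R) (n : nat)
    (lam : n.-tuple nat) (p : path_system lam) :
  system_weight w1 w2 w3 p = \prod_j \prod_(t <- p j) step_weight w1 w2 w3 t.
Proof.
have prod_step (s : seq step) : \prod_(t <- s) step_weight w1 w2 w3 t =
    w1 ^+ count_mem East s * w2 ^+ count_mem North s * w3 ^+ count_mem NorthEast s.
  elim: s => [|t s IH]; first by rewrite big_nil !expr0 !mulr1.
  rewrite big_cons IH /=.
  have EN : (East == North) = false by apply/eqP.
  have EX : (East == NorthEast) = false by apply/eqP.
  have NX : (North == NorthEast) = false by apply/eqP.
  case: t; rewrite ?eqxx ?EN ?EX ?NX ?[North == East]eq_sym ?[NorthEast == _]eq_sym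
    ?EN ?EX ?NX /= !(add0n, add1n) exprS; ring.
under [RHS]eq_bigr do rewrite prod_step.
by rewrite !big_split /= !prodrXr.
Qed.

(** The sweep from the starting points, with all points of the domain ahead. *)
Lemma type2_tilings_eq_paths (R : comNzRingType) (w1 w2 w3 : R) (n : nat)
    (lam : n.-tuple nat) : is_partition lam ->
  \sum_(T | tiling (type2_domain lam) T) tiling_weight w1 w2 w3 T =
  \sum_(p : path_system lam | nonintersecting_H_system p) system_weight w1 w2 w3 p.
Proof.
move=> lam_part; have [S state_S eq_dom] := sweep_start lam_part (leqnn _).
under eq_bigr do rewrite tiling_weightE.
under [RHS]eq_bigr do rewrite system_weightE.
rewrite -eq_dom; exact: sweepE.
Qed.

Lemma H_paths_det (R : comNzRingType) (w1 w2 w3 : R) (n : nat)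
    (lam : n.-tuple nat) : is_partition lam ->
  \sum_(p : path_system lam | nonintersecting_H_system p) system_weight w1 w2 w3 p =
  \det (\matrix_(i, k < n)
    link (step_weight w1 w2 w3) (path_start i) (path_end lam k)).
Proof.
move=> lam_part; have [S [_ _ _ _ _ _ inj stag top size] _] :=
  sweep_start lam_part (leqnn _).
under eq_bigr do rewrite system_weightE.
by apply: (@routes_sum_det _ _ _ _ n.+1%:Z) => //; [exact: goal_inj | exact: goal_staggered].
Qed.

Theorem theorem1p2 (C : numClosedFieldType) (m a : nat) (l : int)
    (hm : (1 <= m)%N) (n : nat) (hn : (1 <= n)%N) :
  tiling_sum (1 : C) (l%:~R - 1) 1 (m - 1) a n
    = path_sum (1 : C) (l%:~R - 1) 1 (m - 1) a n /\
  path_sum (1 : C) (l%:~R - 1) 1 (m - 1) a n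
    = \det (\matrix_(i < n, j < n)
        (l%:~R ^+ (j + 1)
           * gbinom ((m * i)%:R + j%:R + a%:R + 1 : C) (m * i + a + 1)%N%:Z
         + gbinom ((m * i)%:R - j%:R + a%:R - 1 : C) (m * i + a + 1)%N%:Z)).
Proof.
have lam_part := staircase_is_partition (m - 1) a n.
split; first exact: type2_tilings_eq_paths.
rewrite /path_sum H_paths_det //.
pose N (i : 'I_n) := (m * i + a + 1)%N.
have N_gt0 i : (0 < N i)%N by rewrite /N addn1.
have := det_binomials (l%:~R : C) N_gt0.
set A := (X in \det X = _ -> _); set A' := (X in _ -> _ = \det X).
have -> : A' = A.
  apply/matrixP=> i j; rewrite !mxE /N addn1; congr (_ * gbinom _ _ + gbinom _ _).
    by rewrite !natrD; ring.
  by rewrite !natrD; ring.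
(* Rows and columns are numbered from the other end, and transposed. *)
move=> ->; rewrite -det_rev -det_tr; congr (\det _); apply/matrixP=> k i.
rewrite !mxE; have lt_i := ltn_ord i; have lt_k := ltn_ord k.
have end_x : (path_end (staircase (m - 1) a n) (rev_ord k)).1 =
    (N k)%:Z - n%:Z - 1.
  rewrite /path_end tnth_mktuple /= /N -[m in RHS](prednK hm) mulSn subn1.
  have -> : (n - (n - k.+1).+1 = k)%N by lia.
  by move: (m.-1 * k)%N => mk; lia.

have start_x : (path_start (rev_ord i)).1 = i%:Z - n%:Z by rewrite /=; lia.
have start_y : (path_start (rev_ord i)).2 = n%:Z - i%:Z by rewrite /=; lia.
rewrite /link end_x start_x start_y [(path_end _ _).2]/=.
have -> : absz (n.+1%:Z - (n%:Z - i%:Z))%R = i.+1 by lia.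
case: ltnP => lt_N.
  have -> : (i%:Z - n%:Z <= (N k)%:Z - n%:Z - 1) by lia.
  have -> : (n%:Z - i%:Z <= n.+1%:Z) by lia.
  by congr (H_weight _ _ _); lia.
by have -> : (i%:Z - n%:Z <= (N k)%:Z - n%:Z - 1) = false by lia.
Qed.
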